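(* Let $n\ge 4$ and write $n=q^2+r$ with $q$ a positive integer and $r\in\{1,2,\ldots,2q+1\}$. Among all trees on $n$ vertices, consider the second smallest value of the reverse Wiener index $\Lambda$ (the smallest value $n-1$ being attained only by the star $S_n$). Then: (i) for $4\le n\le 56$, this second smallest value equals $\frac{n^2}{2}+\frac{3n}{2}-2-\lfloor\frac{n}{2}\rfloor\lceil\frac{n}{2}\rceil$ and is attained only by $D_{n,\lfloor n/2\rfloor}$; (ii) for $n=57$, it equals $896$ and is attained exactly by $D_{57,28}$, $T_{57,7}(7^{[7]})$ and $T_{57,8}(6^{[8]})$; (iii) for $n\ge 58$, it equals $2q^3+q^2+3rq-3q+2r-2$ if $1\le r\le q$, and $2q^3+q^2+3rq-4q+3r-3$ if $q+1\le r\le 2q+1$, and the trees attaining it are exactly: $T_{n,q}((q-1)^{[q]})$ if $r=1$; $T_{n,q}((q-1)^{[q-r+1]},q^{[r-1]})$ if $2\le r\le q$; $T_{n,q}(q^{[q]})$ and $T_{n,q+1}((q-1)^{[q+1]})$ if $r=q+1$; $T_{n,q+1}((q-1)^{[2(q+1)-r]},q^{[r-q-1]})$ if $q+2\le r\le 2q+1$.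
   Context: All graphs are simple. For a connected graph $G$ on $n$ vertices with diameter $d$, the Wiener index $W(G)$ is the sum of distances over all unordered pairs of vertices, and the reverse Wiener index is $\Lambda(G)=\frac12 n(n-1)d-W(G)$. $S_n$ is the star on $n$ vertices. For $2\le a\le\lfloor n/2\rfloor$, $D_{n,a}$ is the tree obtained from the stars $S_a$ and $S_{n-a}$ by adding an edge between their centers. For integers $k\ge 2$, $n_0\ge 0$, the tree $T_{n,k}(n_0; n_1^{[b_1]},\ldots,n_s^{[b_s]})$ (with $1\le n_1<\cdots<n_s$, $b_i\ge1$, $\sum b_i=k$, $\sum b_in_i=n-n_0-k-1$) is obtained from the star with center $v_0$ and leaves $v_1,\ldots,v_k$ by attaching $n_0$ pendent vertices to $v_0$ and attaching $m_i\ge1$ pendent vertices to $v_i$ ($1\le i\le k$), where among $m_1,\ldots,m_k$ the value $n_j$ occurs exactly $b_j$ times; it has $n$ vertices and diameter 4. When $n_0=0$ it is written $T_{n,k}(n_1^{[b_1]},\ldots,n_s^{[b_s]})$. *)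

(* Defs.v *)
From HB Require Import structures.
From mathcomp Require Import all_boot all_order all_algebra.

Set Implicit Arguments.
Unset Strict Implicit.
Unset Printing Implicit Defensive.

Import Order.TTheory GRing.Theory Num.Theory.

Record sgraph := SGraph {
  vertex :> finType;
  adj : rel vertex;
  adj_sym : symmetric adj;
  adj_irr : irreflexive adj
}.

Definition isomorphic (G H : sgraph) : Prop :=
  exists2 f : G -> H, bijective f & forall x y, adj (f x) (f y) = adj x y.

Definition connected (G : sgraph) : Prop :=
  forall x y : G, connect (@adj G) x y.

(* [ucycle] also accepts an edge run back and forth, a cycle list of size 2. *)
Definition acyclic (G : sgraph) : Prop :=
  forall c : seq G, ucycle (@adj G) c -> size c <= 2.

Definition tree (G : sgraph) : Prop := connected G /\ acyclic G.

Definition tree_on (n : nat) (G : sgraph) : Prop := #|G| = n /\ tree G.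

Definition walk_of_length (G : sgraph) (x y : G) (k : nat) : bool :=
  [exists p : k.-tuple G, path (@adj G) x p && (last x p == y)].

(* Least length of a walk from x to y.  Lengths below #|G| suffice; the value
   is the default #|G| when x and y are not connected. *)
Definition dist (G : sgraph) (x y : G) : nat :=
  find (walk_of_length x y) (iota 0 #|G|).

Definition diameter (G : sgraph) : nat :=
  \max_(x : G) \max_(y : G) dist x y.

(* The enumeration rank selects one ordered pair for each unordered pair. *)
Definition Wiener (G : sgraph) : nat :=
  \sum_(x : G) \sum_(y : G | enum_rank x < enum_rank y) dist x y.

Definition reverse_Wiener (G : sgraph) : rat :=
  (2^-1 * #|G|%:R * (#|G|%:R - 1) * (diameter G)%:R - (Wiener G)%:R)%R.

Section Star.
Variable n : nat.

Definition star_adj (x y : 'I_n) : bool :=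
  (x != y) && ((x == 0 :> nat) || (y == 0 :> nat)).

Lemma star_adj_sym : symmetric star_adj.
Proof. by move=> x y; rewrite /star_adj eq_sym orbC. Qed.

Lemma star_adj_irr : irreflexive star_adj.
Proof. by move=> x; rewrite /star_adj eqxx. Qed.

Definition star : sgraph := SGraph star_adj_sym star_adj_irr.
End Star.

Section DoubleStar.
Variables n a : nat.

Definition D_adj (u v : 'I_a + 'I_(n - a)) : bool :=
  match u, v with
  | inl x, inl y => star_adj x y
  | inr x, inr y => star_adj x y
  | inl x, inr y | inr y, inl x => (x == 0 :> nat) && (y == 0 :> nat)
  end.

Lemma D_adj_sym : symmetric D_adj.
Proof. by case=> x [] y //=; rewrite star_adj_sym. Qed.

Lemma D_adj_irr : irreflexive D_adj.
Proof. by case=> x /=; rewrite star_adj_irr. Qed.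

Definition D_graph : sgraph := SGraph D_adj_sym D_adj_irr.
End DoubleStar.

Definition is_D (n a : nat) (G : sgraph) : Prop :=
  2 <= a <= n./2 /\ isomorphic G (D_graph n a).

(* Vertices: [None] is v_0, [Some (inl _)] are the n_0 pendent vertices at v_0,
   [Some (inr (i, None))] is v_i, and [Some (inr (i, Some _))] are the m_i
   pendent vertices at v_i. *)
Section DiameterFour.
Variables (n0 k : nat) (m : 'I_k -> nat).

Definition T_vertex : finType :=
  option ('I_n0 + {i : 'I_k & option 'I_(m i)}).

Definition T_arc (u v : T_vertex) : bool :=
  match u, v with
  | None, Some (inl _) => true
  | None, Some (inr p) => ~~ isSome (tagged p)
  | Some (inr p), Some (inr p') =>
      [&& tag p == tag p', ~~ isSome (tagged p) & isSome (tagged p')]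
  | _, _ => false
  end.

Definition T_adj (u v : T_vertex) : bool := T_arc u v || T_arc v u.

Lemma T_adj_sym : symmetric T_adj.
Proof. by move=> u v; rewrite /T_adj orbC. Qed.

Lemma T_adj_irr : irreflexive T_adj.
Proof.
by case=> [[x | p] | ] //; rewrite /T_adj orbb /= eqxx; case: (tagged p).
Qed.

Definition T_graph : sgraph := SGraph T_adj_sym T_adj_irr.
End DiameterFour.

(* The parameters n_1^[b_1], ..., n_s^[b_s] are given as the list bs of the
   pairs (n_j, b_j); [tally_seq bs] lists n_1 (b_1 times), ..., n_s (b_s times),
   which serves as m_1, ..., m_k. *)
Definition T_params (n k n0 : nat) (bs : seq (nat * nat)) : Prop :=
  [/\ 2 <= k,
      sorted ltn (unzip1 bs),
      all (fun p => (1 <= p.1) && (1 <= p.2)) bs,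
      \sum_(p <- bs) p.2 = k
    & n0 + k + 1 + \sum_(p <- bs) p.2 * p.1 = n].

Definition is_T (n k n0 : nat) (bs : seq (nat * nat)) (G : sgraph) : Prop :=
  T_params n k n0 bs /\
  isomorphic G (T_graph n0 (fun i : 'I_k => nth 0 (tally_seq bs) i)).

Definition smallest (S : rat -> Prop) (v : rat) : Prop :=
  S v /\ forall w, S w -> (v <= w)%R.

Definition second_smallest (S : rat -> Prop) (v : rat) : Prop :=
  exists2 m, smallest S m & smallest (fun w => S w /\ w <> m) v.

Definition reverse_Wiener_values (n : nat) (v : rat) : Prop :=
  exists2 G, tree_on n G & reverse_Wiener G = v.

Definition attained_exactly_by (n : nat) (v : rat) (P : sgraph -> Prop) : Prop :=
  forall G, (tree_on n G /\ reverse_Wiener G = v) <-> P G.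

(* Main.v *)
Require Import Defs.
From mathcomp Require Import all_boot all_order all_algebra.
From mathcomp Require Import zify ring lra.
Import Order.TTheory GRing.Theory Num.Theory.

(** From diameter five on, the branch sizes no longer determine the tree, so only part of the slack
    between the height of a vertex and half the diameter is kept: small weights on the root and its
    children, or on the two ends of the central edge, already suffice. The bounds so obtained have
    the same shape as the indices in diameters three and four, and the minimisation runs over
    arbitrary lists of integers, whether or not a tree realises them; hence one integer problem
    serves all diameters.

    The threshold comes from growth rates. A balanced double star has index about n^2 / 4, the best
    tree of diameter four about 2 n^(3/2). The leading terms meet at n = 64, and the lower order
    terms move the crossing to n = 57, where 28^2 + 4 * 28 = 16 * 56 = 896. So small n need a finite
    check and polynomial estimates start only at q = 8.

    Isomorphisms are obtained by counting: in all the extremal graphs adjacency depends on a coarse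
    label of the vertices, so equal class sizes suffice. *)

(* The index is half of the sum of diam - d(x, y) over ordered pairs of distinct
   vertices. Root the tree at the middle of a diametral path, so that d(x, y) is
   the sum of the heights of x and y when these lie in different branches and at
   most that sum minus 2 otherwise.

   If the diameter is at most 4, the tree has height at most 2 and is determined
   by the multiset of its branch sizes a_1, ..., a_k; with N = n - 1, the index
   is (k + 1) N + sum a_i^2 when the diameter is 4. If the diameter is even and
   at least 6, the index exceeds this expression in the branch sizes; if it is
   odd and at least 5, it exceeds the index of the double star whose two parts
   have the sizes of the two sides of the central edge.

   It remains to minimise over integers. Double stars are best when balanced.
   For the other expression, (a - t)(a - t - 1) >= 0 gives
   (k + 1) N + sum a_i^2 >= (k + 2 t + 2) N - k t (t + 1) for each t, with
   equality only if all a_i are t or t + 1; the choices t = q - 1, q, q + 1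
   settle every k. *)

Set Implicit Arguments.
Unset Strict Implicit.
Unset Printing Implicit Defensive.

(** * Distances *)

Lemma dist_path_le (G : sgraph) (x : G) p :
  path (@adj G) x p -> dist x (last x p) <= size p.
Proof.
(* A path of [#|G|] or more steps is no obstacle: [find] never exceeds the length of the searched
   list. *)
move=> xp; case: (ltnP (size p) #|G|) => [lt_p|le_p]; last first.
  by apply: leq_trans (find_size _ _) _; rewrite size_iota.
rewrite leqNgt; apply/negP => /(before_find 0).
rewrite nth_iota // add0n => /negbT/negP; apply.
by apply/existsP; exists (in_tuple p); rewrite /= xp eqxx.
Qed.

Lemma dist_path (G : sgraph) (x y : G) : connected G ->
  exists p, [/\ path (@adj G) x p, last x p = y & size p = dist x y].
Proof.
(* Removing repetitions brings the length below [#|G|], into the range that [dist] searches. *)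
move=> /(_ x y) /connectP [p0 xp0 ->]; case/shortenP: xp0 => p xp Up _.
have lt_p : size p < #|G| by have := max_card (mem (x :: p)); rewrite (card_uniqP Up).
have Hw : has (walk_of_length x (last x p)) (iota 0 #|G|).
  apply/hasP; exists (size p); first by rewrite mem_iota.
  by apply/existsP; exists (in_tuple p); rewrite /= xp eqxx.
have := nth_find 0 Hw; move: Hw; rewrite has_find size_iota => ltf.
rewrite nth_iota // add0n => /existsP [t /andP [xt /eqP lt]].
by exists t; rewrite size_tuple.
Qed.

Lemma dist_xx (G : sgraph) (x : G) : dist x x = 0.
Proof. by apply/eqP; rewrite -leqn0; apply: (@dist_path_le _ x [::]). Qed.

Lemma dist_adj_le (G : sgraph) (x y : G) : adj x y -> dist x y <= 1.
Proof. by move=> xy; apply: (@dist_path_le _ x [:: y]); rewrite /= xy. Qed.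

Section ConnectedDistance.
Variable G : sgraph.
Hypothesis conG : connected G.
Implicit Types x y z : G.

Lemma dist_triangle x y z : dist x z <= dist x y + dist y z.
Proof.
have [p [xp lp <-]] := dist_path x y conG; have [r [yr lr <-]] := dist_path y z conG.
rewrite -size_cat -lr -lp -last_cat; apply: dist_path_le.
by rewrite cat_path xp lp.
Qed.

(** Lower bounds on distances come from here: it is enough to exhibit a potential that grows by at
    most one along each edge. *)
Lemma dist_lipschitz (f : G -> nat) x y :
  (forall u v, adj u v -> f v <= (f u).+1) -> f y <= f x + dist x y.
Proof.
move=> Lf; have [p [xp <- <-]] := dist_path x y conG.
elim: p x xp => [|z p IHp] x /=; first by rewrite addn0.
by case/andP => /Lf fz /IHp {IHp}; lia.
Qed.

Lemma dist_sym_le x y : dist x y <= dist y x.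
Proof.
have [p [yp lp <-]] := dist_path y x conG.
rewrite -lp -(size_rev p).
have -> : size (rev p) = size (rev (belast y p)) by rewrite !size_rev size_belast.
have xp : path (@adj G) (last y p) (rev (belast y p)).
  by rewrite rev_path (eq_path (e' := @adj G)) // => u v; rewrite adj_sym.
have := dist_path_le xp; congr (dist _ _ <= _).
by case: (p) => [|z r] //=; rewrite rev_cons last_rcons.
Qed.

Lemma dist_sym x y : dist x y = dist y x.
Proof. by apply/eqP; rewrite eqn_leq !dist_sym_le. Qed.

Lemma dist_eq0 x y : (dist x y == 0) = (x == y).
Proof.
apply/idP/eqP => [|->]; last by rewrite dist_xx.
by have [[|z p] [_ <- <-]] := dist_path x y conG.
Qed.

Lemma dist_split x y a b : dist x y = a + b ->
  exists z, dist x z = a /\ dist z y = b.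
Proof.
move=> dxy; have [p [xp lp sp]] := dist_path x y conG.
exists (last x (take a p)).
move: xp; rewrite -{1}(cat_take_drop a p) cat_path => /andP [p1 p2].
have := dist_path_le p1; have := dist_path_le p2.
rewrite -last_cat cat_take_drop lp size_drop.
rewrite size_take_min => h2 h1.
have := dist_triangle x (last x (take a p)) y; lia.
Qed.

End ConnectedDistance.

Lemma dist_le_diameter (G : sgraph) (x y : G) : dist x y <= diameter G.
Proof.
apply: leq_trans (leq_bigmax (F := fun x => \max_y dist x y) x).
exact: (leq_bigmax (F := fun y => dist x y)).
Qed.

Lemma diameter_attained (G : sgraph) : 0 < #|G| ->
  exists x y : G, dist x y = diameter G.
Proof.
move=> G0; have [x ex] := bigop.eq_bigmax (fun x : G => \max_y dist x y) G0.
have [y ey] := bigop.eq_bigmax (fun y : G => dist x y) G0.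
by exists x, y; rewrite /diameter ex ey.
Qed.

(** * Rooted trees *)

(** A parent function with heights stands in for the absence of cycles: since the edges are exactly
    the parent links, arguments become inductions on the height. [rooted_tree] and [tree_rooted]
    give the equivalence with [tree]. *)
Record rooted (G : sgraph) (c : G) (h : G -> nat) (p : G -> G) : Prop := Rooted {
  height_root : h c = 0;
  height_parent : forall x, x != c -> h x = (h (p x)).+1;
  adj_parent : forall x y, adj x y = (x != c) && (p x == y) || (y != c) && (p y == x)
}.

Section RootedTheory.
Variables (G : sgraph) (c : G) (h : G -> nat) (p : G -> G).
Hypothesis rG : rooted c h p.
Implicit Types x y z : G.

Lemma height_eq0 x : (h x == 0) = (x == c).
Proof.
have [->|/(height_parent rG) ->] := eqVneq x c; first by rewrite (height_root rG).
by [].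
Qed.

Lemma adj_to_parent x : x != c -> adj x (p x).
Proof. by move=> xc; rewrite (adj_parent rG) xc eqxx. Qed.

Lemma path_to_root x : exists s, [/\ path (@adj G) x s, last x s = c & size s = h x].
Proof.
elim: {x}_.+1 {-2}x (ltnSn (h x)) => // m IHm x; rewrite ltnS => lex.
have [xc|xc] := eqVneq x c; first by exists [::]; rewrite xc (height_root rG).
have hx := height_parent rG xc.
have [|s [ps ls ss]] := IHm (p x); first by rewrite -hx.
by exists (p x :: s); rewrite /= adj_to_parent // ps ls ss hx.
Qed.

Lemma rooted_connected : connected G.
Proof.
have toc x : connect (@adj G) x c.
  by have [s [xs <- _]] := path_to_root x; apply/connectP; exists s.
move=> x y; apply: connect_trans (toc x) _.
by rewrite (sym_connect_sym (@adj_sym G)) toc.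
Qed.

Lemma rooted_ind (P : G -> Prop) :
  P c -> (forall x, x != c -> P (p x) -> P x) -> forall x, P x.
Proof.
move=> Pc Pp x; elim: {x}_.+1 {-2}x (ltnSn (h x)) => // m IHm x; rewrite ltnS => lex.
have [->//|xc] := eqVneq x c.
by apply: (Pp _ xc); apply: IHm; rewrite -(height_parent rG xc).
Qed.

(** Both neighbours of a highest vertex on a cycle must be its parent, a child being higher; on a
    cycle of length at least three they are distinct. *)
Lemma rooted_acyclic : acyclic G.
Proof.
move=> s /andP [cs Us]; rewrite leqNgt; apply/negP => s3.
have [x0 x0s] : exists x0, x0 \in s by case: s s3 {cs Us} => // x0 s; exists x0; rewrite inE eqxx.
have [x xs xmax] := @arg_maxnP _ x0 (mem s) h x0s.
have [i s' E] := rot_to xs.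
move: cs Us s3; rewrite -(rot_cycle i) -(rot_uniq i) -(size_rot i s) E.
case: s' E => [|y [|z t]] // E /=; rewrite rcons_path => /and4P [xy _ _ lx].
case/and3P => _ yz _ _.
have par u : u \in s -> adj x u -> u = p x.
  move=> us; rewrite (adj_parent rG) => /orP [/andP [_ /eqP]|/andP [uc /eqP pu]] //.
  by have /= := xmax _ us; rewrite (height_parent rG uc) pu /= ltnn.
have sE u : u \in x :: y :: z :: t -> u \in s by rewrite -E mem_rot.
have yE : y = p x by apply: par xy; apply: sE; rewrite !inE eqxx orbT.
have lE : last z t = p x.
  apply: par; last by rewrite adj_sym.
  by apply: sE; rewrite !(in_cons _ (_ :: _)) mem_last !orbT.
by move/negP: yz; apply; rewrite yE -lE mem_last.
Qed.

Lemma rooted_tree : tree G.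
Proof. by split; [exact: rooted_connected | exact: rooted_acyclic]. Qed.

(** The ancestor at height one, which names the branch of [x]. The truncated predecessor makes the
    root a branch of its own. *)
Definition branch x := iter (h x).-1 p x.

Lemma branch_child x : p x = c -> branch x = x.
Proof.
have [->|xc px] := eqVneq x c; first by rewrite /branch (height_root rG).
by rewrite /branch (height_parent rG xc) px (height_root rG).
Qed.

Lemma branch_root : branch c = c.
Proof. by rewrite /branch (height_root rG). Qed.

Lemma branch_parent x : x != c -> p x != c -> branch (p x) = branch x.
Proof.
move=> xc pxc; rewrite /branch (height_parent rG xc) (height_parent rG pxc) /=.
by rewrite -iterSr.
Qed.

Lemma height_branch x : x != c -> h (branch x) = 1.
Proof.
elim/rooted_ind: x => [|x xc IHx _]; first by rewrite eqxx.
have [pxc|pxc] := eqVneq (p x) c.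
  by rewrite branch_child // (height_parent rG xc) pxc (height_root rG).
by rewrite -branch_parent // IHx.
Qed.

Lemma branch_eq_root x : (branch x == c) = (x == c).
Proof.
have [->|xc] := eqVneq x c; first by rewrite branch_root eqxx.
by apply/eqP => bc; have := height_branch xc; rewrite bc (height_root rG).
Qed.

Let conG := rooted_connected.

Lemma dist_root x : dist x c = h x.
Proof.
apply/eqP; rewrite eqn_leq; apply/andP; split.
  by have [s [xs <- <-]] := path_to_root x; apply: dist_path_le.
suff: h x <= h c + dist c x by rewrite (height_root rG) (dist_sym conG).
apply: (@dist_lipschitz _ conG) => u v.
rewrite (adj_parent rG) => /orP [] /andP [uc /eqP <-];
  by rewrite (height_parent rG uc) // -ltnS ltnW.
Qed.

Lemma dist_le_height x y : dist x y <= h x + h y.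
Proof. by rewrite -!dist_root (dist_sym conG y) (dist_triangle conG). Qed.

Lemma dist_branch x : x != c -> (dist x (branch x)).+1 <= h x.
Proof.
elim/rooted_ind: x => [|x xc IHx _]; first by rewrite eqxx.
have [pxc|pxc] := eqVneq (p x) c.
  by rewrite branch_child // dist_xx (height_parent rG xc).
rewrite -branch_parent // (height_parent rG xc) ltnS.
have := IHx pxc; have := dist_triangle conG x (p x) (branch (p x)).
have := dist_adj_le (adj_to_parent xc); lia.
Qed.

(** A detour through the common child of the root, instead of the root itself, saves two steps. *)
Lemma dist_same_branch x y : x != c -> y != c -> branch x = branch y ->
  (dist x y).+2 <= h x + h y.
Proof.
move=> xc yc bxy; have := dist_branch xc; have := dist_branch yc.
have := dist_triangle conG x (branch x) y.
have : dist (branch x) y = dist y (branch y) by rewrite bxy (dist_sym conG).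
lia.
Qed.

(* The height counted positively in the branch of [x] and negatively elsewhere
   (shifted to stay in [nat]) is 1-Lipschitz. *)
Lemma dist_diff_branch x y : branch x != branch y -> dist x y = h x + h y.
Proof.
move=> bxy; apply/eqP; rewrite eqn_leq dist_le_height /=.
wlog xc : x y bxy / x != c.
  move=> th; have [xc|] := eqVneq x c; last exact: th.
  rewrite (dist_sym conG) addnC; apply: th; first by rewrite eq_sym.
  by apply: contraNneq bxy => yc; rewrite xc yc.
pose f z := if branch z == branch x then h y + h z else h y - h z.
suff: f x <= f y + dist y x by rewrite /f eqxx eq_sym (negPf bxy) (dist_sym conG x); lia.
have fp u : u != c -> f u <= (f (p u)).+1 /\ f (p u) <= (f u).+1.
  move=> uc; rewrite /f; have hu := height_parent rG uc.
  have [puc|puc] := eqVneq (p u) c; last by rewrite branch_parent //; case: ifP; lia.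
  rewrite puc branch_root [c == _]eq_sym branch_eq_root (negPf xc).
  by rewrite puc (height_root rG) in hu; rewrite hu (height_root rG); case: ifP; lia.
apply: (@dist_lipschitz _ conG) => u v.
by rewrite (adj_parent rG) => /orP [] /andP [uc /eqP <-]; have [] := fp _ uc.
Qed.

End RootedTheory.

(** Any neighbour closer to [c] can serve as the parent. The parent links alone connect the graph,
    so a further edge would close a cycle of length at least three. *)
Lemma tree_rooted (G : sgraph) (c : G) : tree G ->
  exists p, rooted c (fun x => dist x c) p.
Proof.
move=> [conG acG].
have ex x : x != c -> exists y, adj x y && (dist x c == (dist y c).+1).
  move=> xc; have [[|y s] [] /=] := dist_path x c conG.
    by move=> _ xc'; rewrite xc' eqxx in xc.
  case/andP => xy ys ls ss; exists y; rewrite xy /=.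
  have := dist_path_le ys; rewrite ls => le_y.
  have := dist_triangle conG x y c; have := dist_adj_le xy; lia.
pose p x := if [pick y | adj x y && (dist x c == (dist y c).+1)] is Some y then y else x.
have pP x : x != c -> adj x (p x) /\ dist x c = (dist (p x) c).+1.
  move=> xc; rewrite /p; case: pickP => [y /andP [? /eqP]|nP] //.
  by have [y] := ex _ xc; rewrite nP.
exists p; split; first exact: dist_xx.
  by move=> x /pP [].
move=> x y; pose e' := [rel x y : G | (x != c) && (p x == y) || (y != c) && (p y == x)].
rewrite -[RHS]/(e' x y); have e'sym : symmetric e' by move=> u v; rewrite /= orbC.
have sub : subrel e' (@adj G).
  move=> u v /= /orP [] /andP [/pP [uv _] /eqP <-] //.
  by rewrite adj_sym.
apply/idP/idP; last exact: sub.
apply: contraTT => e'xy; apply/negP => xy.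
have toc u : connect e' u c.
  elim: {u}_.+1 {-2}u (ltnSn (dist u c)) => // m IHm u; rewrite ltnS => leu.
  have [->//|uc] := eqVneq u c; have [_ du] := pP _ uc.
  apply: connect_trans (IHm (p u) _); last by rewrite -du.
  by apply: connect1; rewrite /= uc eqxx.
have : connect e' x y.
  by apply: connect_trans (toc x) _; rewrite (sym_connect_sym e'sym) toc.
case/connectP => s0 xs0 ly; move: e'xy xy; rewrite ly => {ly}.
case/shortenP: xs0 => s xs Us _ e'xy xy.
(* The simple path of parent links from [x] to [y], closed by the edge, is a cycle; the bound on its
   size leaves only a path of one step, which is itself a parent link. *)
have := acG (x :: s); rewrite /ucycle Us andbT /= rcons_path.
rewrite (sub_path sub xs) adj_sym xy => /(_ isT).
case: s xs e'xy xy {Us} => [|z [|w s]] //=; first by rewrite adj_irr.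
by rewrite andbT => ->.
Qed.

(** * The central root of a tree *)

(** The root sits on a diametral path from [x0] to [y0], half way up to rounding. A vertex too high
    in the branch of [x0] would be too far from [y0], and one too high elsewhere too far from [x0].
    For odd [d] only the branch of [x0] may reach the larger height, so the central edge joins [c]
    to [branch h p x0]. *)
Lemma tree_center (G : sgraph) (d := diameter G) : tree G -> 2 <= d ->
  exists c h p, @rooted G c h p /\ exists x0 y0,
  [/\ x0 != c, y0 != c, h x0 = uphalf d, h y0 = d./2 & [/\
      branch h p x0 != branch h p y0,
      forall x, branch h p x = branch h p x0 -> h x <= uphalf d
    & forall x, branch h p x != branch h p x0 -> h x <= d./2]].
Proof.
move=> tG d2; have [conG _] := tG.
have G0 : 0 < #|G| by rewrite lt0n; apply: contraTneq d2 => G0; rewrite /d /diameter big_pred0 // => x; have := fintype0 x G0.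
have [x0 [y0 dxy]] := diameter_attained G0.
have [|c [xc cy]] := @dist_split _ conG x0 y0 (uphalf d) d./2.
  by rewrite dxy -/d; lia.
have [p] := tree_rooted c tG; set h := (fun x : G => dist x c) => rG.
exists c, h, p; split=> //; exists x0, y0.
have x0c : x0 != c by rewrite -(dist_eq0 conG); lia.
have y0c : y0 != c by rewrite -(dist_eq0 conG) (dist_sym conG); lia.
have hy0 : h y0 = d./2 by rewrite /h (dist_sym conG).
(* In a common branch their distance would be at most [d - 2]. *)
have bxy : branch h p x0 != branch h p y0.
  apply/eqP => /(dist_same_branch rG x0c y0c); rewrite dxy -/d hy0 [h x0]xc; lia.
split=> //; split=> // x bx.
  have := dist_le_diameter x y0; rewrite (dist_diff_branch rG) ?bx // -/d hy0; lia.
have := dist_le_diameter x x0; rewrite (dist_diff_branch rG) // -/d [h x0]xc; lia.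
Qed.

(** * The deficit sum *)

(* Twice the reverse Wiener index, as a natural number. *)
Definition deficit (G : sgraph) : nat :=
  \sum_(x : G) \sum_(y : G | y != x) (diameter G - dist x y).

Lemma sum_neq_const (T : finType) (x : T) k : \sum_(y | y != x) k = (#|T| - 1) * k.
Proof.
rewrite sum_nat_cond_const; congr (_ * _).
by rewrite subn1 -(cardsC1 x); apply: eq_card => y; rewrite !inE.
Qed.

Lemma sum_dist_neq (G : sgraph) (x : G) :
  \sum_(y : G | y != x) dist x y = \sum_y dist x y.
Proof. by rewrite [RHS](bigD1 x) //= dist_xx. Qed.

Lemma deficitE (G : sgraph) :
  deficit G + \sum_(x : G) \sum_y dist x y = #|G| * (#|G| - 1) * diameter G.
Proof.
rewrite /deficit -big_split /= -mulnA -sum_nat_const.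
apply: eq_bigr => x _; rewrite -sum_dist_neq -big_split /= -(sum_neq_const x).
by apply: eq_bigr => y _; rewrite subnK // dist_le_diameter.
Qed.

Lemma sum_dist_Wiener (G : sgraph) : connected G ->
  \sum_(x : G) \sum_y dist x y = 2 * Wiener G.
Proof.
move=> conG; rewrite mul2n -addnn /Wiener.
rewrite [X in _ = _ + X](exchange_big_dep predT) //= -big_split /=.
apply: eq_bigr => x _; rewrite (bigID (fun y => enum_rank x < enum_rank y)) /=.
congr (_ + _); rewrite [LHS](bigD1 x) ?ltnn //= dist_xx add0n.
apply: eq_big => [y|y _]; last by rewrite (dist_sym conG).
by rewrite -leqNgt ltn_neqAle andbC (inj_eq val_inj) (inj_eq enum_rank_inj).
Qed.

Lemma reverse_Wiener_deficit (G : sgraph) : connected G -> 0 < #|G| ->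
  reverse_Wiener G = ((deficit G)%:R / 2)%R.
Proof.
move=> conG G0; have := deficitE G; rewrite (sum_dist_Wiener conG).
move/(congr1 (fun k => k%:R : rat)); rewrite natrD !natrM natrB // => E.
have -> : ((deficit G)%:R = #|G|%:R * (#|G|%:R - 1) * (diameter G)%:R - 2 * (Wiener G)%:R :> rat)%R.
  by rewrite -E addrK.
by rewrite /reverse_Wiener; field.
Qed.

Lemma sum_neq_weights (T : finType) (w : T -> nat) :
  \sum_x \sum_(y | y != x) (w x + w y) = 2 * (#|T| - 1) * \sum_x w x.
Proof.
have E : \sum_x \sum_(y : T | y != x) w x = (#|T| - 1) * \sum_x w x.
  by rewrite big_distrr; apply: eq_bigr => x _; rewrite sum_neq_const.
under eq_bigr => x _ do rewrite big_split.
rewrite big_split /= E [X in _ + X](exchange_big_dep predT) //=.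
have -> : \sum_y \sum_(x : T | y != x) w y = \sum_y \sum_(x | x != y) w y.
  by apply: eq_bigr => y _; apply: eq_bigl => x; rewrite eq_sym.
by rewrite E -mulnA mul2n addnn.
Qed.

(** The term [#|T|] restores the diagonal pairs; a class with s elements then accounts for s^2
    pairs. *)
Lemma sum_neq_same (T J : finType) (g : T -> J) :
  \sum_x \sum_(y | y != x) (g x == g y) + #|T| = \sum_j #|[pred x | g x == j]| ^ 2.
Proof.
rewrite -sum1_card -big_split /=.
transitivity (\sum_x #|[pred y | g y == g x]|).
  apply: eq_bigr => x _; rewrite -sum1_card [RHS]big_mkcond /= [RHS](bigD1 x) //= inE eqxx addnC.
  by congr (_ + _); apply: eq_bigr => y _; rewrite inE eq_sym; case: (_ == _).
rewrite (partition_big g predT) //=; apply: eq_bigr => j _.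
rewrite (eq_bigr (fun=> #|[pred x | g x == j]|)); last by move=> x /eqP ->.
by rewrite sum_nat_cond_const cardsE.
Qed.

(** * Isomorphism *)

Lemma isomorphic_trans (G H K : sgraph) :
  isomorphic G H -> isomorphic H K -> isomorphic G K.
Proof.
move=> [f fb fadj] [g gb gadj]; exists (g \o f); first exact: bij_comp.
by move=> x y; rewrite /= gadj fadj.
Qed.

Lemma isomorphic_card (G H : sgraph) : isomorphic G H -> #|G| = #|H|.
Proof. by move=> [f fb _]; exact: bij_eq_card fb. Qed.

Lemma walk_map (G H : sgraph) (f : G -> H) (x y : G) k :
  (forall x y, adj (f x) (f y) = adj x y) ->
  walk_of_length x y k -> walk_of_length (f x) (f y) k.
Proof.
move=> fadj /existsP [t /andP [xt /eqP <-]]; apply/existsP; exists (map_tuple f t).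
rewrite /= last_map eqxx andbT path_map.
by rewrite (eq_path (e' := @adj G)) // => u v; rewrite /= fadj.
Qed.

Lemma dist_isomorphic (G H : sgraph) (f : G -> H) (x y : G) : bijective f ->
  (forall x y, adj (f x) (f y) = adj x y) -> dist (f x) (f y) = dist x y.
Proof.
move=> fb fadj; rewrite /dist (bij_eq_card fb); apply: eq_find => k.
apply/idP/idP; last exact: walk_map.
have [g gK fK] := fb; rewrite -{2}(gK x) -{2}(gK y); apply: walk_map => u v.
by rewrite -fadj !fK.
Qed.

Lemma diameter_isomorphic (G H : sgraph) : isomorphic G H -> diameter G = diameter H.
Proof.
move=> [f fb fadj].
rewrite /diameter [RHS](reindex f) //=; last exact: onW_bij.
apply: eq_bigr => x _; rewrite [RHS](reindex f) //=; last exact: onW_bij.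
by apply: eq_bigr => y _; rewrite dist_isomorphic.
Qed.

Lemma deficit_isomorphic (G H : sgraph) : isomorphic G H -> deficit G = deficit H.
Proof.
move=> iGH; have dGH := diameter_isomorphic iGH; have [f fb fadj] := iGH.
rewrite /deficit [RHS](reindex f) //=; last exact: onW_bij.
apply: eq_bigr => x _; rewrite [RHS](reindex f) //=; last exact: onW_bij.
by apply: eq_big => [y|y _]; rewrite ?(bij_eq fb) // dist_isomorphic ?dGH.
Qed.

Lemma rooted_isomorphic (G H : sgraph) (c : H) h p :
  isomorphic G H -> rooted c h p -> tree G.
Proof.
move=> [f [g gK fK] fadj] rH.
apply: (@rooted_tree G (g c) (h \o f) (g \o p \o f)).
have E x : (x != g c) = (f x != c) by rewrite (can2_eq gK fK).
split=> /=; first by rewrite fK (height_root rH).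
  by move=> x; rewrite E fK => /(height_parent rH).
move=> x y; rewrite -fadj (adj_parent rH) !E.
by rewrite -(can2_eq fK gK) -(can2_eq fK gK).
Qed.

(** Any bijection that preserves labels is an isomorphism. One exists because the i-th element of
    each class can be sent to the i-th element of the class with the same label; doing so in both
    directions gives two injections between finite types. *)
Lemma isomorphic_labels (G H : sgraph) (L : eqType) (lG : G -> L) (lH : H -> L)
    (e : rel L) :
  (forall x y, adj x y = e (lG x) (lG y)) ->
  (forall x y, adj x y = e (lH x) (lH y)) ->
  (forall l, #|[pred x | lG x == l]| = #|[pred x | lH x == l]|) ->
  isomorphic G H.
Proof.
move=> eG eH ecard.
have inj (G' H' : finType) (l1 : G' -> L) (l2 : H' -> L) :
    (forall l, #|[pred x | l1 x == l]| = #|[pred x | l2 x == l]|) ->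
    exists2 f : G' -> H', injective f & forall x, l2 (f x) = l1 x.
  move=> ec.
  have rk x : index x (enum [pred z | l1 z == l1 x]) < size (enum [pred y | l2 y == l1 x]).
    by rewrite -cardE -ec cardE index_mem mem_enum inE.
  have y0 (x : G') : H'.
    by case: (enum [pred y | l2 y == l1 x]) (rk x).
  pose f x := nth (y0 x) (enum [pred y | l2 y == l1 x])
                  (index x (enum [pred z | l1 z == l1 x])).
  have fl x : l2 (f x) = l1 x.
    by apply/eqP; have := mem_nth (y0 x) (rk x); rewrite mem_enum inE.
  exists f => // x x' fxx'; have ll : l1 x = l1 x' by rewrite -!fl fxx'.
  move: fxx'; rewrite /f (set_nth_default (y0 x')) // -ll => /eqP.
  rewrite nth_uniq ?enum_uniq //; last by rewrite ll.
  move/eqP => /(congr1 (nth x (enum [pred z | l1 z == l1 x]))).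
  by rewrite !nth_index ?mem_enum ?inE // ll.
have [f finj fl] := inj _ _ _ _ ecard.
have [g ginj _] := inj _ _ _ _ (fun l => esym (ecard l)).
exists f; first exact: inj_card_bij (leq_card _ ginj).
by move=> x y; rewrite eG eH !fl.
Qed.

Lemma diameter_eq (G : sgraph) (x0 y0 : G) d :
  (forall x y : G, dist x y <= d) -> dist x0 y0 = d -> diameter G = d.
Proof.
move=> le_d d0; apply/eqP; rewrite eqn_leq -{2}d0 dist_le_diameter andbT.
by apply/bigmax_leqP => x _; apply/bigmax_leqP => y _.
Qed.

(** Height two leaves so little room that the estimate of [dist_same_branch] is exact: in one
    branch, a child and its leaf are at distance 1, two leaves at distance 2. *)
Lemma dist_height2 (G : sgraph) (c : G) h p (x y : G) : rooted c h p ->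
  (forall x, h x <= 2) -> y != x ->
  dist x y + 2 * (branch h p x == branch h p y) = h x + h y.
Proof.
move=> rG h2 yx; have conG := rooted_connected rG.
have [bxy|bxy] := eqVneq (branch h p x) (branch h p y); last first.
  by rewrite (dist_diff_branch rG) // muln0 addn0.
have xc : x != c.
  apply: contraNneq yx => xc; rewrite xc -(branch_eq_root rG) -bxy xc.
  by rewrite (branch_root rG).
have yc : y != c by rewrite -(branch_eq_root rG) -bxy (branch_eq_root rG).
have := dist_same_branch rG xc yc bxy; have := h2 x; have := h2 y.
have := height_eq0 rG x; have := height_eq0 rG y; have := dist_eq0 conG x y.
rewrite (negPf xc) (negPf yc) [x == y]eq_sym (negPf yx) => d0 hy0 hx0 hy hx le_d.
(* A vertex of height one is its own branch. *)
have h11 : (h x == 1) && (h y == 1) -> False.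
  case/andP => /eqP hx1 /eqP hy1; move: bxy; rewrite /branch hx1 hy1 /= => xy.
  by rewrite xy eqxx in yx.
(* Every edge joins two different heights. *)
have d22 : (h x == 2) && (h y == 2) -> dist x y != 1.
  case/andP => /eqP hx2 /eqP hy2.
  have [s [xs ly <-]] := dist_path x y conG; case: s xs ly => [|z [|z' s]] //=.
  rewrite andbT (adj_parent rG) => + zy; rewrite zy {zy} => /orP [] /andP [uc /eqP pu].
    by have := height_parent rG uc; rewrite pu; lia.
  by have := height_parent rG uc; rewrite pu; lia.
case: (h x =P 2) h11 d22 => [->|]; case: (h y =P 2) => [->|]; lia.
Qed.

Lemma sum_dist_height2 (G : sgraph) (c : G) h p : rooted c h p ->
  (forall x, h x <= 2) ->
  \sum_(x : G) \sum_y dist x y + 2 * \sum_j #|[pred x | branch h p x == j]| ^ 2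
    = 2 * (#|G| - 1) * \sum_x h x + 2 * #|G|.
Proof.
move=> rG h2; rewrite -sum_neq_same mulnDr addnA; congr (_ + _).
rewrite -sum_neq_weights big_distrr -big_split /=; apply: eq_bigr => x _.
rewrite -sum_dist_neq big_distrr -big_split /=; apply: eq_bigr => y yx.
exact: (dist_height2 rG).
Qed.

(** * Trees of diameter at least five *)

Lemma sum_pred (T : finType) (P : pred T) : \sum_x (P x : nat) = #|P|.
Proof.
by rewrite -sum1_card [RHS]big_mkcond; apply: eq_bigr => x _; rewrite unfold_in; case: (P x).
Qed.

Lemma same_branch_nonroot (G : sgraph) (c : G) h p (x y : G) : rooted c h p ->
  y != x -> branch h p x = branch h p y -> x != c /\ y != c.
Proof.
move=> rG yx bxy.
have bxy' : (x == c) = (y == c) by rewrite -(branch_eq_root rG) -[RHS](branch_eq_root rG) bxy.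
suff xc : x != c by rewrite -bxy'.
by apply: contraNneq yx => xc; move: bxy'; rewrite xc eqxx => /esym/eqP ->.
Qed.

Lemma sum_branch_sizes (G : sgraph) (c : G) h p : rooted c h p ->
  \sum_(j | h j == 1) #|[pred x | branch h p x == j]| = #|G| - 1.
Proof.
move=> rG; rewrite subn1 -(cardC1 c) -sum1_card.
rewrite [RHS](partition_big (branch h p) (fun j => h j == 1)) /=; last first.
  by move=> x; rewrite !inE => xc; rewrite (height_branch rG xc).
apply: eq_bigr => j /eqP hj; rewrite -sum1_card; apply: eq_bigl => x.
rewrite !inE; have [bx|] := eqVneq; last by rewrite andbF.
rewrite andbT -(branch_eq_root rG) bx; apply/esym; apply/eqP => jc.
by rewrite jc (height_root rG) in hj.
Qed.

(** Turns a bound on the slack [diameter G - dist x y] of single pairs into one on the deficit. The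
    term [t * #|G|] pays for the diagonal, which the sum of squares includes. *)
Lemma deficit_weights (G : sgraph) (J : finType) (g : G -> J) (w : G -> nat) t :
  (forall x y : G, y != x -> w x + w y + t * (g x == g y) + dist x y <= diameter G) ->
  2 * (#|G| - 1) * \sum_x w x + t * \sum_j #|[pred x | g x == j]| ^ 2
    <= deficit G + t * #|G|.
Proof.
move=> le_d; rewrite -sum_neq_same mulnDr addnA leq_add2r.
rewrite -sum_neq_weights big_distrr -big_split /=; apply: leq_sum => x _.
rewrite big_distrr -big_split /=; apply: leq_sum => y yx.
by rewrite leq_subRL ?dist_le_diameter // addnC le_d.
Qed.

Lemma diameter_card (G : sgraph) : 0 < diameter G -> 1 < #|G|.
Proof.
move=> d0.
have G0 : 0 < #|G|.
  rewrite lt0n; apply: contraTneq d0 => G0.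
  by rewrite /diameter big_pred0 // => x; have := fintype0 x G0.
have [x [y dxy]] := diameter_attained G0; rewrite ltnNge; apply/negP.
move/(@fintype_le1P G) => /(_ x y) xy; move: d0.
by rewrite -dxy xy dist_xx.
Qed.

(** With K branches, the weights below add up to K + 3. The diagonal costs about one unit of weight,
    so K + 2 takes the place of the coefficient K + 1 in the formula for diameter four, which makes
    the inequality strict. *)
Lemma deficit_even_diameter (G : sgraph) : tree G ->
  ~~ odd (diameter G) -> 6 <= diameter G ->
  exists2 s, sumn s = #|G| - 1 &
    2 * ((size s + 1) * (#|G| - 1) + \sum_(a <- s) a ^ 2) < deficit G.
Proof.
set d := diameter G => tG dodd d6.
have [|c [h [p [rG]]]] := tree_center tG; first by rewrite -/d; lia.
rewrite -/d => -[x0 [y0 [_ _ _ _ [_ hB hA]]]].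
have hle x : h x <= d./2.
  have [/hB|/hA//] := eqVneq (branch h p x) (branch h p x0); lia.
have N0 : 1 < #|G| by apply: diameter_card; rewrite -/d; lia.
pose a j := #|[pred x | branch h p x == j]|.
exists [seq a j | j <- enum [pred j | h j == 1]].
  rewrite sumnE big_map big_enum /=; exact: (sum_branch_sizes rG).
rewrite size_map -cardE big_map big_enum /=.
(* The weights must fit below [d./2 - h z]. As [d./2] is at least 3, the root can carry 3, and a
   child, with slack at least 2, can carry 1. *)
pose w z := 3 * (z == c) + (h z == 1).
have := @deficit_weights G G (branch h p) w 2.
have -> : \sum_x w x = 3 + #|[pred j | h j == 1]|.
  by rewrite big_split /= -big_distrr /= !sum_pred card1.
(* The root is a class of size one, which offsets its own diagonal term. *)
have : 1 + \sum_(j | h j == 1) a j ^ 2 <= \sum_j a j ^ 2.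
  rewrite [leqRHS](bigD1 c) //=; apply: leq_add.
    have -> : a c = 1; last by [].
    rewrite -(card1 c); apply: eq_card => x; rewrite !inE.
    exact: (branch_eq_root rG).
  rewrite big_mkcond [leqRHS]big_mkcond; apply: leq_sum => j _.
  case: eqP => //= hj; case: eqP => //= jc.
  by rewrite jc (height_root rG) in hj.
set A := \sum_(j | h j == 1) _; set K := #|_|; rewrite -/d.
set B := \sum_j _ => leAB /(_ _) H.
have {}H : 2 * (#|G| - 1) * (3 + K) + 2 * B <= deficit G + 2 * #|G|.
  apply: H => x y yx; rewrite /w -(height_eq0 rG x) -(height_eq0 rG y).
  have := hle x; have := hle y.
  have [bxy|_] := eqVneq (branch h p x) (branch h p y); last by have := dist_le_height rG x y; lia.
  have [xc yc] := same_branch_nonroot rG yx bxy.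
  have := dist_same_branch rG xc yc bxy; lia.
move: N0 H leAB; move: (deficit G) #|G|; clearbody A K B.
clear => D [|[|N]] // _ H leAB; move: H; rewrite subn1 /=; nia.
Qed.

(** The two sides of the central edge play the role of the stars of a double star. The total weight
    4 contributes twice the main term [4 * (#|G| - 1)] of a double star, whence strictness. *)
Lemma deficit_odd_diameter (G : sgraph) : tree G ->
  odd (diameter G) -> 5 <= diameter G ->
  exists a b, a + b = #|G| /\
    4 * (#|G| - 1) + a ^ 2 + b ^ 2 < deficit G + #|G|.
Proof.
set d := diameter G => tG dodd d5.
have [|c [h [p [rG]]]] := tree_center tG; first by rewrite -/d; lia.
rewrite -/d => -[x0 [y0 [x0c _ _ _ [_ hB hA]]]].
have N0 : 1 < #|G| by apply: diameter_card; rewrite -/d; lia.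
pose v := branch h p x0; pose g x := branch h p x == v.
have hv : h v = 1 by exact: (height_branch rG).
have gv : g v by rewrite /g /branch hv.
have gc : g c = false.
  by apply/negbTE; rewrite /g (branch_root rG) eq_sym (branch_eq_root rG).
pose w z := 2 * ((z == c) + (z == v)).
have := @deficit_weights G bool g w 1.
have -> : \sum_x w x = 4.
  by rewrite -big_distrr big_split /= !sum_pred !card1.
rewrite big_bool /= !mul1n -/d => H.
exists #|[pred x | g x == true]|, #|[pred x | g x == false]|; split.
  rewrite -(cardC [pred x | g x == true]); congr (_ + _); apply: eq_card => x.
  by rewrite !inE; case: (g x).
move: H; set a := #|[pred x | g x == true]|; set b := #|[pred x | g x == false]| => H.
have {}H : 2 * (#|G| - 1) * 4 + (a ^ 2 + b ^ 2) <= deficit G + #|G|.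
  apply: H => x y yx; rewrite mul1n.
  (* The side of [v] may be one level higher, hence [g z]. Two vertices on different sides then
     total at most [d]. On the side of [c] the total is at most [d - 1]; on the side of [v] it is at
     most [d + 1], but the common branch saves 2. Either way one unit remains for a pair on the same
     side. *)
  have hw z : w z + h z <= d./2 + g z.
    rewrite /w; have [->|_] := eqVneq z c.
      rewrite (height_root rG) gc; have -> : (c == v) = false; last by lia.
      by apply/negbTE; apply: contraFneq gc => ->.
    have [->|_] := eqVneq z v; first by rewrite gv hv; lia.
    rewrite /g -/v; case: eqP => [/hB|/eqP/hA]; lia.
  have := hw x; have := hw y; have := dist_le_height rG x y.
  case gx: (g x); case gy: (g y) => /=; try lia.
  have bxy : branch h p x = branch h p y by rewrite (eqP gx) (eqP gy).
  have [xc yc] := same_branch_nonroot rG yx bxy.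
  have := dist_same_branch rG xc yc bxy; lia.
by move: N0 H; move: (a ^ 2) (b ^ 2) #|G| (deficit G); clear=> A B n D; lia.
Qed.

(** * Trees of height two *)

Lemma sum_option (A : finType) (F : option A -> nat) :
  \sum_x F x = F None + \sum_a F (Some a).
Proof.
rewrite (bigD1 None) //= (reindex_omap Some id) /=; last by case.
by congr (_ + _); apply: eq_bigl => a; rewrite eqxx.
Qed.

Section TGraph.
Variables (k : nat) (m : 'I_k -> nat).
Local Notation T := (T_graph 0 m).

Definition T_root : T := None.
Definition T_child (i : 'I_k) : T := Some (inr (existT (fun i => option 'I_(m i)) i None)).
Definition T_leaf (i : 'I_k) (j : 'I_(m i)) : T :=
  Some (inr (existT (fun i => option 'I_(m i)) i (Some j))).

Lemma T_ind (P : T -> Prop) : P T_root -> (forall i, P (T_child i)) ->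
  (forall i j, P (@T_leaf i j)) -> forall x, P x.
Proof.
move=> P0 P1 P2 [[[? //]|[i [j|]]]|]; [exact: P2 | exact: P1 | exact: P0].
Qed.

Lemma sum_T (F : T -> nat) :
  \sum_x F x = F T_root + \sum_i (F (T_child i) + \sum_j F (@T_leaf i j)).
Proof.
rewrite [LHS]sum_option; congr (_ + _); rewrite big_sumType /= big_ord0 add0n.
have := @sig_big_dep _ 0 addn 'I_k (fun i => option 'I_(m i)) predT (fun i => predT)
  (fun i o => F (Some (inr (existT (fun i => option 'I_(m i)) i o)))).
move=> E; transitivity (\sum_(i < k) \sum_(o : option 'I_(m i))
   F (Some (inr (existT (fun i => option 'I_(m i)) i o)))).
  by rewrite E; apply: eq_bigr => -[i o].
by apply: eq_bigr => i _; rewrite sum_option.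
Qed.

Definition T_height (x : T) : nat :=
  match x with
  | Some (inr p) => if tagged p is Some _ then 2 else 1
  | _ => 0
  end.

Definition T_parent (x : T) : T :=
  match x with
  | Some (inr p) => if tagged p is Some _ then T_child (tag p) else T_root
  | _ => T_root
  end.

Definition T_branch (x : T) : option 'I_k :=
  if x is Some (inr p) then Some (tag p) else None.

(** Leaves at the same [v_i] are twins, so the label forgets which one is meant; branch and level
    are enough to decide adjacency, by [T_edge]. *)
Definition T_label (x : T) : option (nat * bool) :=
  if x is Some (inr p) then Some (val (tag p), isSome (tagged p)) else None.

Lemma T_child_eq i i' : (T_child i == T_child i') = (i == i').
Proof. by apply/eqP/eqP => [[]|->]. Qed.

Lemma T_rooted : rooted T_root T_height T_parent.
Proof.
split=> //; first by elim/T_ind.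
move=> x y; elim/T_ind: x => [|i|i j]; elim/T_ind: y => [|i'|i' j'] //=;
  rewrite /adj /= /T_adj /= ?andbF ?andbT ?orbF //.
- by rewrite T_child_eq eq_sym.
- by rewrite T_child_eq.
- by apply/esym/norP; split; apply/eqP => /(congr1 T_label).
Qed.

Lemma T_height_le2 x : T_height x <= 2.
Proof. by elim/T_ind: x. Qed.

Lemma T_branchE x y :
  (branch T_height T_parent x == branch T_height T_parent y) = (T_branch x == T_branch y).
Proof.
elim/T_ind: x => [|i|i j]; elim/T_ind: y => [|i'|i' j'] //=; rewrite /branch /=;
  by rewrite T_child_eq; apply/eqP/eqP => [->|[]].
Qed.

Lemma T_dist x y : x != y ->
  dist x y + 2 * (T_branch x == T_branch y) = T_height x + T_height y.
Proof.
rewrite eq_sym => yx.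
by have := dist_height2 T_rooted T_height_le2 yx; rewrite T_branchE.
Qed.

Lemma card_T : #|T| = (\sum_i (m i).+1).+1.
Proof.
rewrite -sum1_card sum_T add1n; congr _.+1; apply: eq_bigr => i _.
by rewrite sum_nat_const card_ord muln1.
Qed.

Lemma sum_T_height : \sum_x T_height x = \sum_i (1 + 2 * m i).
Proof.
rewrite sum_T; apply: eq_bigr => i _ /=.
by rewrite sum_nat_const card_ord mulnC.
Qed.

Lemma card_T_branch i : #|[pred x | T_branch x == Some i]| = (m i).+1.
Proof.
have -> : #|[pred x | T_branch x == Some i]| = \sum_x (T_branch x == Some i).
  by rewrite sum_pred.
rewrite sum_T /= add0n (bigD1 i) //= eqxx sum_nat_const card_ord muln1 add1n.
rewrite big1 ?addn0 // => j ji.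
have -> : (Some j == Some i) = false by apply/eqP => -[] /eqP; rewrite (negPf ji).
by rewrite big1.
Qed.

Lemma sum_T_dist :
  \sum_(x : T) \sum_y dist x y + 2 * \sum_i (m i).+1 ^ 2
    = 2 * (#|T| - 1) * (\sum_i (1 + 2 * m i) + 1).
Proof.
have := sum_dist_height2 T_rooted T_height_le2; rewrite sum_T_height.
rewrite -!sum_neq_same.
have -> : \sum_x \sum_(y | y != x) (branch T_height T_parent x == branch T_height T_parent y)
        = \sum_x \sum_(y | y != x) (T_branch x == T_branch y).
  by apply: eq_bigr => x _; apply: eq_bigr => y _; rewrite T_branchE.
rewrite sum_neq_same sum_option.
have -> : #|[pred x | T_branch x == None]| = 1.
  by rewrite -(card1 T_root); apply: eq_card; elim/T_ind.
have -> : \sum_(i < k) #|[pred x | T_branch x == Some i]| ^ 2 = \sum_i (m i).+1 ^ 2.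
  by apply: eq_bigr => i _; rewrite card_T_branch.
set D := \sum_x \sum_y dist _ _; set A := \sum_i _ ^ 2; set B := \sum_i _.
have : 0 < #|T| by rewrite card_T.
by move: D A B; case: #|T| => // n D A B _; rewrite subn1 /=; nia.
Qed.

Lemma T_tree : tree T.
Proof. exact: rooted_tree T_rooted. Qed.

Lemma Some_eq (A : eqType) (x y : A) : (Some x == Some y) = (x == y).
Proof. by apply/eqP/eqP => [[]|->]. Qed.

Lemma T_dist_le x y : dist x y <= T_height x + T_height y.
Proof. exact: dist_le_height T_rooted x y. Qed.

Lemma T_diameter2 (i0 i1 : 'I_k) : i0 != i1 -> (forall i, m i = 0) -> diameter T = 2.
Proof.
move=> i01 m0.
have h1 x : T_height x <= 1.
  by elim/T_ind: x => // i [j lt_j]; exfalso; move: lt_j; rewrite m0.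
apply: (@diameter_eq _ (T_child i0) (T_child i1)) => [x y|].
  by have := T_dist_le x y; have := h1 x; have := h1 y; lia.
have /= := @T_dist (T_child i0) (T_child i1).
by rewrite T_child_eq Some_eq (negPf i01) => /(_ isT); lia.
Qed.

Lemma T_diameter3 (i0 i1 : 'I_k) : i0 != i1 -> 0 < m i0 ->
  (forall i, i != i0 -> m i = 0) -> diameter T = 3.
Proof.
move=> i01 mi0 m0.
have h1 x : T_height x <= 1 + (T_branch x == Some i0).
  elim/T_ind: x => [|i|i j] //=; rewrite Some_eq; case: eqP => // /eqP /m0 mi.
  by exfalso; case: j => j; rewrite mi.
apply: (@diameter_eq _ (T_leaf (Ordinal mi0)) (T_child i1)) => [x y|].
  have [->|/T_dist] := eqVneq x y; first by rewrite dist_xx.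
  have := h1 x; have := h1 y.
  case: (T_branch x =P Some i0) => [->|_]; last by lia.
  by rewrite [Some i0 == _]eq_sym; lia.
have neq : T_leaf (Ordinal mi0) != T_child i1.
  by apply/eqP => /(congr1 T_branch) /eqP; rewrite Some_eq (negPf i01).
by have /= := T_dist neq; rewrite Some_eq (negPf i01); lia.
Qed.

Lemma T_diameter4 (i0 i1 : 'I_k) : i0 != i1 -> 0 < m i0 -> 0 < m i1 ->
  diameter T = 4.
Proof.
move=> i01 mi0 mi1.
apply: (@diameter_eq _ (T_leaf (Ordinal mi0)) (T_leaf (Ordinal mi1))) => [x y|].
  by have := T_dist_le x y; have := T_height_le2 x; have := T_height_le2 y; lia.
have neq : T_leaf (Ordinal mi0) != T_leaf (Ordinal mi1).
  by apply/eqP => /(congr1 T_branch) /eqP; rewrite Some_eq (negPf i01).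
by have /= := T_dist neq; rewrite Some_eq (negPf i01); lia.
Qed.

End TGraph.

Definition T_edge (l l' : option (nat * bool)) : bool :=
  match l, l' with
  | None, Some (_, b) | Some (_, b), None => ~~ b
  | Some (i, b), Some (i', b') => (i == i') && (b != b')
  | None, None => false
  end.

Lemma T_adjE k (m : 'I_k -> nat) (x y : T_graph 0 m) :
  adj x y = T_edge (T_label x) (T_label y).
Proof.
elim/T_ind: x => [|i|i j]; elim/T_ind: y => [|i'|i' j'] //=;
  rewrite /adj /= /T_adj /= ?andbF ?andbT ?orbF //.
Qed.

Lemma card_T_label k (m : 'I_k -> nat) l : #|[pred x : T_graph 0 m | T_label x == l]| =
  match l with
  | None => 1
  | Some (i, false) => i < k
  | Some (i, true) => nth 0 [seq m i | i <- enum 'I_k] i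
  end.
Proof.
transitivity (\sum_(x : T_graph 0 m) (T_label x == l)); first by rewrite sum_pred.
rewrite sum_T /=; case: l => [[i b]|]; last first.
  by rewrite big1 // => i _; rewrite big1.
rewrite add0n; have [lt_i|le_i] := ltnP i k; last first.
  (* For an index out of range the default 0 is the right count: no vertex has such a label. *)
  rewrite nth_default; last by rewrite size_map size_enum_ord.
  have ne (j : 'I_k) b' : (Some (val j, b') == Some (i, b)) = false.
    by apply/eqP => -[ji _]; have := ltn_ord j; rewrite ji ltnNge le_i.
  rewrite big1 => [|j _]; first by case: b {ne}.
  by rewrite ne big1 // => j' _; rewrite ne.
rewrite (bigD1 (Ordinal lt_i)) //= [X in _ + X = _]big1 => [|j ji]; last first.
  have ne b' : (Some (val j, b') == Some (i, b)) = false.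
    by apply: contraNF ji => /eqP [ji' _]; apply/eqP/val_inj.
  by rewrite ne big1 // => j' _; rewrite ne.
rewrite !Some_eq !xpair_eqE eqxx /= addn0 sum_nat_const card_ord.
rewrite (nth_map (Ordinal lt_i)) ?size_enum_ord // .
have -> : nth (Ordinal lt_i) (enum 'I_k) i = Ordinal lt_i.
  by apply: val_inj; rewrite /= nth_enum_ord.
by case: b; rewrite ?muln1 ?muln0.
Qed.

(* The entries 0 of [s] give the pendent vertices at the root, so that [n0 = 0]. *)
Definition T_seq (s : seq nat) : sgraph := T_graph 0 (fun i : 'I_(size s) => nth 0 s i).

Lemma card_T_seq_label s l : #|[pred x : T_seq s | T_label x == l]| =
  match l with
  | None => 1
  | Some (i, false) => i < size s
  | Some (i, true) => nth 0 s i
  end.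
Proof.
rewrite card_T_label; case: l => [[i []]|] //; congr nth.
apply: (@eq_from_nth _ 0); rewrite size_map size_enum_ord // => j lt_j.
by rewrite (nth_map (Ordinal lt_j)) ?size_enum_ord // nth_enum_ord.
Qed.

Lemma sum_nth (F : nat -> nat) s :
  \sum_(i < size s) F (nth 0 s i) = \sum_(a <- s) F a.
Proof. by rewrite (big_nth 0) big_mkord. Qed.

Lemma card_T_seq s : #|T_seq s| = (size s + sumn s).+1.
Proof.
rewrite card_T (sum_nth (fun a => a.+1)); congr _.+1.
by elim: s => [|a s IHs]; rewrite ?big_nil // big_cons IHs /=; lia.
Qed.

(** The diameter is left open because zero entries may lower it to 2 or 3; one identity thus serves
    stars, double stars and diameter four, where the terms in [N * (N + 1)] cancel. *)
Lemma deficit_T_seq s (N := size s + sumn s) :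
  deficit (T_seq s) + 4 * N * (N + 1)
    = diameter (T_seq s) * N * (N + 1) + 2 * ((size s + 1) * N + \sum_(a <- s) a.+1 ^ 2).
Proof.
have := deficitE (T_seq s); have := sum_T_dist (fun i : 'I_(size s) => nth 0 s i).
rewrite -/(T_seq s) card_T_seq -/N (sum_nth (fun a => 1 + 2 * a)).
rewrite (sum_nth (fun a => a.+1 ^ 2)) subn1 /=.
have -> : \sum_(a <- s) (1 + 2 * a) = size s + 2 * sumn s.
  by elim: (s) => [|a s' IHs]; rewrite ?big_nil // big_cons IHs /=; lia.
set D := \sum_x \sum_y dist _ _; set A := \sum_(a <- s) _.
have : N = size s + sumn s by [].
move: D A (deficit _) (diameter _) N (size s) (sumn s) => D A F d N K M eN e1 e2.
subst N; nia.
Qed.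

(** Up to isomorphism only the numbers of leaves at the children of the root matter. Sorting the
    children makes the sequence canonical, to be compared later with a [tally_seq]. *)
Lemma rooted_T_seq (G : sgraph) (c : G) h p : rooted c h p ->
  (forall x, h x <= 2) -> exists2 s, sorted leq s & isomorphic G (T_seq s).
Proof.
move=> rG h2.
pose m x := #|[pred y | (h y == 2) && (p y == x)]|.
pose cs := sort (relpre m leq) (enum [pred x | h x == 1]).
have Ucs : uniq cs by rewrite sort_uniq enum_uniq.
have mem_cs x : (x \in cs) = (h x == 1) by rewrite mem_sort mem_enum inE.
have hp x : x != c -> h x = (h (p x)).+1 by exact: (height_parent rG).
have h0 x : (x == c) = (h x == 0) by rewrite (height_eq0 rG).
have p_cs x : h x = 2 -> p x \in cs.
  by move=> hx; rewrite mem_cs; have := hp x; rewrite h0 hx => /(_ isT) [<-].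
have p_c x : h x = 1 -> p x = c.
  by move=> hx; apply/eqP; rewrite h0; have := hp x; rewrite h0 hx => /(_ isT) [<-].
pose lab x : option (nat * bool) :=
  if h x == 0 then None else if h x == 1 then Some (index x cs, false)
  else Some (index (p x) cs, true).
have idx x i : x \in cs -> (index x cs == i) = (i < size cs) && (nth c cs i == x).
  move=> xcs; apply/eqP/andP => [<-|[lt_i /eqP <-]]; last by rewrite index_uniq.
  by rewrite index_mem nth_index.
have hcase x : [\/ h x = 0, h x = 1 | h x = 2].
  by have := h2 x; case: (h x) => [|[|[|]]] // _; [constructor 1 | constructor 2 | constructor 3].
exists (map m cs); first by rewrite sorted_map sort_sorted // => x y /=; apply: leq_total.
apply: (@isomorphic_labels _ _ _ lab (@T_label _ _) T_edge).
- move=> x y; rewrite (adj_parent rG) /lab !h0.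
  have pE u v : h u = 1 -> h v != 0 -> p u == v = false.
    by move=> /p_c -> hv; rewrite eq_sym h0 (negPf hv).
  have pE2 u v : h u = 2 -> h v != 1 -> p u == v = false.
    by move=> /p_cs; rewrite mem_cs => hu; apply: contraNF => /eqP <-.
  have ind u v : h u = 1 -> h v = 2 -> (index u cs == index (p v) cs) = (p v == u).
    move=> /eqP; rewrite -mem_cs => ucs /p_cs vcs.
    by rewrite (inj_in_eq (@index_inj _ c cs)) // eq_sym.
  case: (hcase x) => hx; case: (hcase y) => hy; rewrite !hx !hy /= ?(eqxx, andbF, orbF, andbT) //.
  + by rewrite p_c // eq_sym h0 hx.
  + by rewrite pE2 ?hx.
  + by rewrite p_c // eq_sym h0 hy.
  + by rewrite !pE ?hx ?hy.
  + by rewrite pE ?hy // ind.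
  + by rewrite pE2 ?hy.
  + by rewrite (pE y x) ?hx // orbF [index _ _ == _]eq_sym ind.
  + by rewrite !pE2 ?hx ?hy.
- by move=> x y; exact: T_adjE.
- move=> l; rewrite [RHS](card_T_seq_label (map m cs) l) size_map; case: l => [[i b]|]; last first.
    rewrite -(card1 c); apply: eq_card => x; rewrite !inE /lab h0.
    by case: (hcase x) => ->.
  have lab1 x : h x = 1 -> (lab x == Some (i, b)) = ~~ b && (i < size cs) && (nth c cs i == x).
    move=> hx; rewrite /lab hx /= Some_eq xpair_eqE idx ?mem_cs ?hx //.
    by case: (b) => /=; rewrite ?andbF ?andbT.
  have lab2 x : h x = 2 -> (lab x == Some (i, b)) = b && (i < size cs) && (nth c cs i == p x).
    move=> hx; rewrite /lab hx /= Some_eq xpair_eqE idx ?p_cs //.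
    by case: (b) => /=; rewrite ?andbF ?andbT.
  have lab0 x : h x = 0 -> (lab x == Some (i, b)) = false by move=> hx; rewrite /lab hx.
  have [lt_i|le_i] := ltnP i (size cs); last first.
    rewrite nth_default ?size_map //.
    transitivity 0; last by case: (b).
    apply: eq_card0 => x; rewrite inE.
    case: (hcase x) => hx; [exact: lab0 | rewrite lab1 // | rewrite lab2 //];
      by rewrite ltnNge le_i andbF.
  have nth_cs : h (nth c cs i) = 1 by apply/eqP; rewrite -mem_cs mem_nth.
  rewrite (nth_map c) //; case: b lab0 lab1 lab2 => lab0 lab1 lab2.
    apply: eq_card => x; rewrite !inE.
    case: (hcase x) => hx; [rewrite lab0 // hx // | rewrite lab1 // hx // |].
    by rewrite lab2 // hx /= lt_i eq_sym.
  transitivity #|pred1 (nth c cs i)|; last by rewrite card1.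
  apply: eq_card => x; rewrite !inE.
  case: (hcase x) => hx; [rewrite lab0 // | rewrite lab1 //= | rewrite lab2 //=].
  + by apply/esym/eqP => xE; rewrite -xE hx in nth_cs.
  + by rewrite lt_i eq_sym.
  + by apply/esym/eqP => xE; rewrite -xE hx in nth_cs.
Qed.

(** * Stars and double stars *)

Definition starlike (G : sgraph) (c : G) : Prop :=
  forall x y, adj x y = ((x == c) != (y == c)).

(** The classes partition the vertices, so the size of the class of [l0] follows from the others and
    the total. *)
Lemma card_label_eq (T1 T2 : finType) (L : eqType) (f1 : T1 -> L) (f2 : T2 -> L)
    (ls : seq L) (l0 : L) :
  uniq (l0 :: ls) -> (forall x, f1 x \in l0 :: ls) -> (forall x, f2 x \in l0 :: ls) ->
  #|T1| = #|T2| -> {in ls, forall l, #|[pred x | f1 x == l]| = #|[pred x | f2 x == l]|} ->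
  forall l, #|[pred x | f1 x == l]| = #|[pred x | f2 x == l]|.
Proof.
move=> Uls m1 m2 eT els.
have tot (T : finType) (f : T -> L) : (forall x, f x \in l0 :: ls) ->
    #|T| = #|[pred x | f x == l0]| + \sum_(l <- ls) #|[pred x | f x == l]|.
  move=> mf; transitivity (\sum_(l <- l0 :: ls) \sum_(x : T) (f x == l)); last first.
    by rewrite big_cons sum_pred; congr (_ + _); apply: eq_bigr => l _; rewrite sum_pred.
  rewrite exchange_big /= -sum1_card; apply: eq_bigr => x _.
  rewrite (bigD1_seq (f x)) //= eqxx big1 // => l /negPf lf.
  by rewrite eq_sym lf.
have e0 : #|[pred x | f1 x == l0]| = #|[pred x | f2 x == l0]|.
  move: eT; rewrite (tot _ f1) // (tot _ f2) //.
  by rewrite (eq_big_seq _ els) => /addIn.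
move=> l; have [|nl] := boolP (l \in l0 :: ls).
  by rewrite inE => /orP [/eqP ->|/els].
by rewrite !eq_card0 // => x; rewrite inE; apply: contraNF nl => /eqP <-.
Qed.

Lemma starlike_isomorphic (G H : sgraph) (c : G) (c' : H) :
  starlike c -> starlike c' -> #|G| = #|H| -> isomorphic G H.
Proof.
move=> sG sH cGH.
apply: (@isomorphic_labels _ _ _ (pred1 c) (pred1 c') (fun b b' => b != b')) => //.
apply: (@card_label_eq _ _ _ _ _ [:: true] false) => //; try by move=> x; case: (pred1 _ x).
have t (T : finType) (z : T) : #|[pred x | (x == z) == true]| = 1.
  by rewrite -(card1 z); apply: eq_card => x; rewrite !inE eqb_id.
by move=> l; rewrite inE => /eqP ->; rewrite !t.
Qed.

Lemma star_starlike n (n0 : 0 < n) : @starlike (star n) (Ordinal n0).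
Proof.
move=> x y; rewrite /adj /= /star_adj -![_ == Ordinal _](inj_eq val_inj) /= -(inj_eq val_inj) /=.
by case: (val x) (val y) => [|u] [|v] //=; rewrite andbF.
Qed.

(** A double star seen through labels: [A] is one side of the central edge [u v], and adjacency
    depends only on the side and on being an end of that edge. The sizes of [A] and of [G] then
    determine the graph. *)
Definition bistarlike (G : sgraph) (A : pred G) (u v : G) : Prop :=
  [/\ A u, ~~ A v & forall x y, adj x y =
    if A x == A y then ((x == u) || (x == v)) != ((y == u) || (y == v))
    else ((x == u) || (x == v)) && ((y == u) || (y == v))].

Lemma bistarlike_sym (G : sgraph) (A : pred G) u v :
  bistarlike A u v -> bistarlike (predC A) v u.
Proof.
move=> [Au Av adjE]; split; rewrite /= ?negbK // => x y.
by rewrite adjE ![(_ == v) || _]orbC; case: (A x); case: (A y).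
Qed.

Lemma bistarlike_isomorphic (G H : sgraph) (A : pred G) (B : pred H) u v u' v' :
  bistarlike A u v -> bistarlike B u' v' -> #|A| = #|B| -> #|G| = #|H| ->
  isomorphic G H.
Proof.
move=> [Au Av adjG] [Bu Bv adjH] cAB cGH.
pose lab (K : sgraph) (C : pred K) (s t x : K) := (C x, (x == s) || (x == t)).
apply: (@isomorphic_labels _ _ _ (lab G A u v) (lab H B u' v')
  (fun l l' => if l.1 == l'.1 then l.2 != l'.2 else l.2 && l'.2)) => //.
apply: (@card_label_eq _ _ _ _ _ [:: (true, true); (false, true); (true, false)]
  (false, false)) => //; try by move=> x; rewrite /lab; case: (_ x); case: orb.
have tt (K : sgraph) (C : pred K) s t : C s -> ~~ C t ->
    #|[pred x | lab K C s t x == (true, true)]| = 1.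
  move=> Cs Ct; rewrite -(card1 s); apply: eq_card => x; rewrite !inE xpair_eqE eqb_id.
  have [->|xs] := eqVneq x s; first by rewrite Cs.
  by have [->|xt] := eqVneq x t; rewrite /= ?(negPf Ct) // andbF.
have ft (K : sgraph) (C : pred K) s t : C s -> ~~ C t ->
    #|[pred x | lab K C s t x == (false, true)]| = 1.
  move=> Cs Ct; rewrite -(card1 t); apply: eq_card => x; rewrite !inE xpair_eqE.
  have [->|xt] := eqVneq x t; first by rewrite (negPf Ct) orbT.
  by have [->|xs] := eqVneq x s; rewrite /= ?Cs // andbF.
have tf (K : sgraph) (C : pred K) s t : C s -> ~~ C t ->
    #|[pred x | lab K C s t x == (true, false)]| + 1 = #|C|.
  move=> Cs Ct; rewrite (cardD1 s) [s \in C]Cs addnC; congr (_ + _).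
  apply: eq_card => x; rewrite !inE xpair_eqE eqb_id [x \in C]unfold_in.
  have [->|xs] := eqVneq x s; first by rewrite andbF.
  by have [->|xt] := eqVneq x t; rewrite /= ?(negPf Ct) ?andbT.
move=> l; rewrite !inE => /or3P [] /eqP ->; rewrite ?tt ?ft //.
by apply: (@addIn 1); rewrite !tf.
Qed.

Lemma D_bistarlike n a (a0 : 0 < a) (b0 : 0 < n - a) :
  @bistarlike (D_graph n a) (fun x => if x is inl _ then true else false)
    (inl (Ordinal a0)) (inr (Ordinal b0)).
Proof.
have eqL (x : 'I_a) : (inl x == inl (Ordinal a0) :> 'I_a + 'I_(n - a)) = (val x == 0).
  by apply/eqP/eqP => [[->]|x0] //; congr inl; apply: val_inj.
have eqR (x : 'I_(n - a)) : (inr x == inr (Ordinal b0) :> 'I_a + 'I_(n - a)) = (val x == 0).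
  by apply/eqP/eqP => [[->]|x0] //; congr inr; apply: val_inj.
have st k (x y : 'I_k) : (x != y) && ((val x == 0) || (val y == 0))
    = ((val x == 0) != (val y == 0)).
  by rewrite -(inj_eq val_inj) /=; case: (val x) (val y) => [|i] [|j] //=; rewrite andbF.
split=> // -[x|x] [y|y]; rewrite /adj /= /star_adj ?eqL ?eqR /= ?orbF //.
exact: andbC.
Qed.

Lemma card_D n a : a <= n -> #|D_graph n a| = n.
Proof. by move=> le_a; rewrite card_sum !card_ord subnKC. Qed.

Lemma card_D_left n a :
  #|(fun x => if x is inl _ then true else false) : pred (D_graph n a)| = a.
Proof.
rewrite -sum1_card big_mkcond big_sumType /=.
by rewrite sum_nat_const card_ord muln1 big1 ?addn0.
Qed.

Lemma T_starlike k (m : 'I_k -> nat) : (forall i, m i = 0) ->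
  @starlike (T_graph 0 m) (T_root m).
Proof.
move=> m0 x y; elim/T_ind: x => [|i|i [j lt_j]]; last by exfalso; rewrite m0 in lt_j.
  by elim/T_ind: y => [|i'|i' [j lt_j]] //; exfalso; rewrite m0 in lt_j.
by elim/T_ind: y => [|i'|i' [j lt_j]] //; [rewrite T_adjE /= andbF | exfalso; rewrite m0 in lt_j].
Qed.

Lemma T_leaf_child k (m : 'I_k -> nat) i (j : 'I_(m i)) i' :
  (T_leaf j == T_child m i') = false.
Proof. by apply/eqP => /(congr1 (@T_label _ _)). Qed.

(** With a single branch the centre is [v_1], and the root is one of the leaves. *)
Lemma T_starlike1 (m : 'I_1 -> nat) : @starlike (T_graph 0 m) (T_child m ord0).
Proof.
have i0 (i : 'I_1) : val i = 0 by rewrite ord1.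
by move=> x y; rewrite T_adjE; elim/T_ind: x => [|i|i j]; elim/T_ind: y => [|i'|i' j'];
  rewrite ?T_child_eq ?T_leaf_child /= ?i0 ?(ord1 i) ?(ord1 i').
Qed.

(** The branch of [i0] is a star around its child; all other vertices form a star around the
    root. *)
Lemma T_bistarlike k (m : 'I_k -> nat) i0 : (forall i, i != i0 -> m i = 0) ->
  @bistarlike (T_graph 0 m) (fun x => T_branch x == Some i0) (T_child m i0) (T_root m).
Proof.
move=> m0; split=> [||x y]; [by rewrite /= eqxx | by [] | rewrite T_adjE].
have lf i (j : 'I_(m i)) : i == i0.
  by apply: contraT => /m0 mi; case: j => j; rewrite mi.
have vE (i i' : 'I_k) : (val i == val i') = (i == i') by rewrite (inj_eq val_inj).
elim/T_ind: x => [|i|i j]; elim/T_ind: y => [|i'|i' j'];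
  rewrite ?T_child_eq ?T_leaf_child /= ?Some_eq ?(lf _ j) ?(lf _ j') ?orbF //=.
- by case: (i' == i0).
- by case: (i == i0).
- by rewrite andbF; case: (i == i0); case: (i' == i0).
- have -> : (val i == i') = (i == i0) by rewrite vE (eqP (lf _ j')).
  by case: (i == i0).
- have -> : (val i == i') = (i' == i0) by rewrite vE (eqP (lf _ j)) eq_sym.
  by case: (i' == i0).
- by rewrite andbF.
Qed.

Lemma star_T_seq n : 0 < n -> isomorphic (star n) (T_seq (nseq n.-1 0)).
Proof.
move=> n0; apply: (starlike_isomorphic (star_starlike n0) (T_starlike _)).
  by move=> i; rewrite nth_nseq if_same.
by rewrite card_ord [RHS](card_T_seq (nseq n.-1 0)) size_nseq sumn_nseq mul0n addn0 prednK.
Qed.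

(** The first star is the branch of the child with [a.-1] leaves; the second is centred at the root,
    its leaves being the children with entry 0. *)
Lemma D_T_seq n a : 0 < a < n ->
  isomorphic (D_graph n a) (T_seq (a.-1 :: nseq (n - a).-1 0)).
Proof.
case/andP => a0 an; have b0 : 0 < n - a by rewrite subn_gt0.
apply: (bistarlike_isomorphic (D_bistarlike a0 b0) (@T_bistarlike _ _ ord0 _)).
- by move=> [[|i] lt_i] //= _; rewrite nth_nseq if_same.
- by rewrite card_D_left [RHS]card_T_branch /= prednK.
- rewrite (card_D (ltnW an)) [RHS](card_T_seq (a.-1 :: nseq (n - a).-1 0)) /= size_nseq sumn_nseq.
  by rewrite mul0n addn0 prednK // -addnS prednK // subnK // ltnW.
Qed.

Lemma deficit_star n : 3 <= n -> deficit (star n) = 2 * (n - 1).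
Proof.
case: n => [|[|[|n]]] // _; rewrite (deficit_isomorphic (star_T_seq _)) // succnK.
have := deficit_T_seq (nseq n.+2 0); rewrite sumn_nseq size_nseq mul0n addn0.
rewrite (@T_diameter2 _ _ ord0 ord_max) //; last first.
  by move=> i; rewrite nth_nseq if_same.
by rewrite big_nseq iter_addn_0; move: (deficit _) => F; nia.
Qed.

Lemma deficit_D n a : 2 <= a -> a + 2 <= n ->
  deficit (D_graph n a) + n = 4 * (n - 1) + a ^ 2 + (n - a) ^ 2.
Proof.
move=> a2 an; rewrite (deficit_isomorphic (D_T_seq _)); last by lia.
have [k ->] : exists k, n = a + k.+2 by exists (n - a - 2); lia.
case: a a2 {an} => [|[|a]] // _; rewrite addKn /=.
have := deficit_T_seq (a.+1 :: nseq k.+1 0); rewrite /= sumn_nseq size_nseq mul0n addn0.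
rewrite (@T_diameter3 _ _ ord0 ord_max) //; last first.
  by move=> [[|i] lt_i] //= _; rewrite -[0 :: _]/(nseq k.+1 0) nth_nseq if_same.
rewrite -[0 :: nseq k 0]/(nseq k.+1 0) big_cons big_nseq iter_addn_0.
by move: (deficit _) => F; nia.
Qed.

(** * Classification of trees by diameter *)

Lemma isomorphic_tree_on n (G H : sgraph) (c : H) h p :
  isomorphic G H -> rooted c h p -> #|H| = n -> tree_on n G.
Proof.
by move=> iGH rH cH; split; [rewrite (isomorphic_card iGH) | apply: rooted_isomorphic iGH rH].
Qed.

Lemma isomorphic_T_seq_tree_on n (G : sgraph) s :
  isomorphic G (T_seq s) -> (size s + sumn s).+1 = n -> tree_on n G.
Proof. by move=> iG <-; apply: isomorphic_tree_on iG (T_rooted _) (card_T_seq s). Qed.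

Lemma tree_height2 (G : sgraph) : tree G -> 0 < #|G| -> diameter G <= 4 ->
  exists2 s, sorted leq s & isomorphic G (T_seq s).
Proof.
move=> tG /card_gt0P [x0 _] d4; have [d2|d2] := leqP 2 (diameter G).
  have [c [h [p [rG [x1 [y1 [_ _ _ _ [_ hB hA]]]]]]]] := tree_center tG d2.
  apply: (rooted_T_seq rG) => x.
  have [/hB|/hA] := eqVneq (branch h p x) (branch h p x1); lia.
(* For diameter below 2 there is no central root to find, and any vertex will do. *)
have [p rG] := tree_rooted x0 tG; apply: (rooted_T_seq rG) => x.
by have := dist_le_diameter x x0; lia.
Qed.

(** For diameter at most four, the number of nonzero entries decides: none gives a star, one a
    double star, two or more diameter four. The exception is a nonzero entry that stands alone,
    which gives a star. *)
Lemma tree_cases n (G : sgraph) : 3 <= n -> tree_on n G ->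
  [\/ isomorphic G (star n),
      exists2 a, 2 <= a <= n./2 & isomorphic G (D_graph n a),
      exists s, [/\ sorted leq s, (size s + sumn s).+1 = n, isomorphic G (T_seq s)
                  & diameter (T_seq s) = 4]
    | 5 <= diameter G].
Proof.
move=> n3 [cG tG]; have [d4|d5] := leqP (diameter G) 4; last by constructor 4.
have [|s ss iG] := tree_height2 tG _ d4; first by rewrite cG; lia.
have cT : #|T_seq s| = n by rewrite -cG (isomorphic_card iG).
have n0 : 0 < n by lia.
have cS : #|star n| = n by rewrite card_ord.
pose m (i : 'I_(size s)) := nth 0 s i.
have [|] := boolP [forall i, m i == 0].
  move/forallP => m0; constructor 1; apply: isomorphic_trans iG _.
  apply: (starlike_isomorphic (T_starlike _) (star_starlike n0)); last by rewrite cT cS.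
  by move=> i; apply/eqP; exact: m0.
rewrite negb_forall => /existsP [i0 mi0].
have [|] := boolP [forall i, (i != i0) ==> (m i == 0)]; last first.
  rewrite negb_forall => /existsP [i1]; rewrite negb_imply => /andP [i10 mi1].
  constructor 3; exists s; split=> //; first by rewrite -card_T_seq.
  by apply: (@T_diameter4 _ _ i0 i1); rewrite 1?eq_sym // lt0n.
move/forallP => m0'.
have m0 i : i != i0 -> m i = 0 by move=> ii0; have := m0' i; rewrite ii0 => /eqP.
have [k1|k2] := leqP (size s) 1.
  constructor 1; apply: isomorphic_trans iG _.
  have sz1 : size s = 1 by have := ltn_ord i0; lia.
  clear -cT sz1 n0 cS; case: s cT sz1 => [|a [|b s]] // cT _; apply: (starlike_isomorphic (@T_starlike1 _) (star_starlike n0)).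
  by rewrite cS -cT.
have bT := T_bistarlike m0.
have cA : #|(fun x : T_seq s => T_branch x == Some i0)| = (m i0).+1 by exact: card_T_branch.
have szs : size s + m i0 < n.
  have := cT; rewrite card_T_seq => <-; rewrite ltnS leq_add2l /m.
  by rewrite sumnE (big_nth 0) big_mkord (bigD1 i0) //= leq_addr.
constructor 2; case: (leqP (m i0).+1 n./2) => le_a.
  exists (m i0).+1; first by rewrite le_a ltnS lt0n mi0.
  apply: isomorphic_trans iG _.
  have b0 : 0 < n - (m i0).+1 by lia.
  apply: (bistarlike_isomorphic bT (D_bistarlike (ltn0Sn _) b0)).
    by rewrite card_D_left.
  by rewrite cT card_D //; lia.
(* Here the branch is the larger side, so the two sides are exchanged to keep [a] at most [n./2]. *)
have a0 : 0 < n - (m i0).+1 by lia.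
exists (n - (m i0).+1); first by apply/andP; split; lia.
apply: isomorphic_trans iG _.
have b0 : 0 < n - (n - (m i0).+1) by lia.
apply: (bistarlike_isomorphic (bistarlike_sym bT) (D_bistarlike a0 b0)).
  rewrite card_D_left; have := cardC (fun x : T_seq s => T_branch x == Some i0).
  by rewrite cA cT => <-; rewrite addKn; apply: eq_card => x; rewrite !inE.
by rewrite cT card_D //; lia.
Qed.

(** * Minimising the index *)

(** The list [b] holds the branch sizes, which count the child with its leaves; this is the shift
    [a.+1] wherever a sequence of [T_seq] is evaluated. *)
Definition T_value (b : seq nat) : nat := (size b + 1) * sumn b + \sum_(a <- b) a ^ 2.

(* The minima of the index over the trees of diameter four, resp. three, on
   [n = q ^ 2 + r] vertices; no subtraction truncates if [q, r > 0] and [n > 3]. *)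
Definition T_min (q r : nat) : nat :=
  if r <= q then 2 * q ^ 3 + q ^ 2 + 3 * r * q + 2 * r - (3 * q + 2)
  else 2 * q ^ 3 + q ^ 2 + 3 * r * q + 3 * r - (4 * q + 3).

Definition D_min (n : nat) : nat :=
  if odd n then n./2 ^ 2 + 4 * n./2 else n./2 ^ 2 + 3 * n./2 - 2.

(* Sums the inequality [(a - t) * (a - t - 1) >= 0] over the entries. *)
Lemma sum_squares_ge t b :
  (2 * t + 1) * sumn b <= \sum_(a <- b) a ^ 2 + size b * (t * (t + 1)) /\
  ((2 * t + 1) * sumn b = \sum_(a <- b) a ^ 2 + size b * (t * (t + 1)) ->
   all (fun a => (a == t) || (a == t + 1)) b).
Proof.
elim: b => [|a b [IH1 IH2]]; first by rewrite big_nil muln0.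
rewrite big_cons /=; move: (\sum_(j <- b) j ^ 2) (sumn b) (size b) IH1 IH2 => S N k IH1 IH2.
have : (2 * t + 1) * a <= a ^ 2 + t * (t + 1) /\
    ((2 * t + 1) * a = a ^ 2 + t * (t + 1) -> (a == t) || (a == t + 1)).
  have [le_a|lt_a] := leqP a t.
    have [e ->] : exists e, t = a + e by exists (t - a); lia.
    split; first by nia.
    by case: e => [|e]; [rewrite addn0 eqxx | nia].
  have [e ->] : exists e, a = t + 1 + e by exists (a - t - 1); lia.
  split; first by nia.
  by case: e => [|e]; [rewrite addn0 eqxx orbT | nia].
move=> [H1 H2]; split; first by nia.
by move=> E; rewrite H2 ?IH2 //; nia.
Qed.

Lemma T_value_ge t b :
  (size b + 2 * t + 2) * sumn b <= T_value b + size b * (t * (t + 1)).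
Proof. by have [] := sum_squares_ge t b; rewrite /T_value; nia. Qed.


(** Let N be the sum and k the length of [b]. The bound for t is affine in k with slope N - t (t +
    1). For t = q the slope is negative if r <= q, so lengths up to q are best at k = q, and t = q -
    1 excludes longer lists; it is positive if r >= q + 2, so lengths from q + 1 on are best at k =
    q + 1, and t = q + 1 excludes shorter ones. If r = q + 1 the slope vanishes and no length is
    singled out, which is the origin of the tie. *)
Lemma T_min_spec q r b : 0 < q -> 1 <= r <= 2 * q + 1 -> sumn b + 1 = q ^ 2 + r ->
  T_min q r <= T_value b /\ (T_value b = T_min q r ->
    [/\ all (fun a => (a == q) || (a == q + 1)) b,
        r <= q -> size b = q & q + 2 <= r -> size b = q + 1]).
Proof.
move=> q0 /andP [r1 r2] eN.
suff [le_F eqF] : T_min q r <= T_value b /\ (T_value b = T_min q r ->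
    [/\ (size b + 2 * q + 2) * sumn b = T_value b + size b * (q * (q + 1)),
        r <= q -> size b = q & q + 2 <= r -> size b = q + 1]).
  split=> // /eqF [E ? ?]; split=> //.
  by have [_] := sum_squares_ge q b; apply; move: E; rewrite /T_value; nia.
have := T_value_ge q b; have := T_value_ge q.-1 b; have := T_value_ge q.+1 b.
move: (T_value b) (size b) (sumn b) eN => F K N eN Hp Hm H0.
have [rq|rq] := leqP r q.
  (* So [T_min q r] is the bound for t = q at length q. *)
  have EV : T_min q r + q ^ 3 + q ^ 2 = (3 * q + 2) * N.
    rewrite /T_min rq; have [r' E] : exists r', r = r'.+1 by exists r.-1; lia.
    have -> : N = q ^ 2 + r' by lia.
    by rewrite E; nia.
  have Nlt : N < q ^ 2 + q by lia.
  have Nge : q ^ 2 <= N by lia.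
  have [Kq|Kq] := leqP K q.
    have [e Eq] : exists e, q = K + e by exists (q - K); lia.
    have h1 : e * N <= e * (q ^ 2 + q) by rewrite leq_mul2l ltnW ?orbT.
    have h2 : 0 < e -> e * N < e * (q ^ 2 + q) by move=> e0; rewrite ltn_pmul2l.
    split; first by move: H0 h1 EV; rewrite Eq; clear; lia.
    move=> EF; have e0 : e = 0.
      case: (posnP e) => // /h2; move: H0 EV EF; rewrite Eq; clear; lia.
    split; [|lia|lia]; rewrite e0 addn0 in Eq.
    by move: EV EF; rewrite -Eq; clear; lia.
  have [p Eq] : exists p, q = p.+1 by exists q.-1; lia.
  have [e EK] : exists e, K = q + 1 + e by exists (K - q - 1); lia.
  have h1 : e * q ^ 2 <= e * N by rewrite leq_mul2l Nge orbT.
  (* The bound for t = q - 1 at length q + 1 exceeds [T_min q r] by q^2 + q - N, which is positive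
     here. *)
  have lt1 : (3 * q + 2) * N < F + q ^ 3 + q ^ 2.
    by move: Hm h1 Nlt; rewrite EK Eq /=; clear; nia.
  by split; lia.
have [rq1|rq1] := eqVneq r q.+1.
  have EN : N = q * (q + 1) by nia.
  have EV : T_min q r = (2 * q + 2) * N.
    by rewrite /T_min leqNgt rq /= rq1 EN; clear; nia.
  rewrite -EN in H0 *; split; first by move: H0 EV; clear; lia.
  by move=> EF; split; [move: EF EV; clear; lia | lia | lia].
(* Now [T_min q r] is the bound for t = q at length q + 1. *)
have EV : T_min q r + q * (q + 1) ^ 2 = (3 * q + 3) * N.
  rewrite /T_min leqNgt rq /=; have [r' E] : exists r', r = r'.+1 by exists r.-1; lia.
  have -> : N = q ^ 2 + r' by lia.
  by move: rq; rewrite E; clear; nia.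
have Ngt : q ^ 2 + q < N by lia.
have Nle : N <= q ^ 2 + 2 * q by lia.
have [Kq|Kq] := leqP K q.
  have [e Eq] : exists e, q = K + e by exists (q - K); lia.
  have h1 : e * N <= e * ((q + 1) * (q + 2)).
    by rewrite leq_mul2l; apply/orP; right; move: Nle; clear; nia.
  (* The bound for t = q + 1 at length q exceeds [T_min q r] by N - q^2 - q. *)
  have lt1 : (3 * q + 3) * N < F + q * (q + 1) ^ 2.
    by move: Hp h1 Ngt; rewrite Eq; clear; lia.
  by split; lia.
have [e EK] : exists e, K = q + 1 + e by exists (K - q - 1); lia.
have h1 : e * (q ^ 2 + q) <= e * N by rewrite leq_mul2l ltnW ?orbT.
have h2 : 0 < e -> e * (q ^ 2 + q) < e * N by move=> e0; rewrite ltn_pmul2l.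
split; first by move: H0 h1 EV; rewrite EK; clear; lia.
move=> EF; have e0 : e = 0.
  case: (posnP e) => // /h2; move: H0 EV EF; rewrite EK; clear; lia.
split; [|lia|lia]; rewrite e0 addn0 in EK.
by move: EV EF; rewrite EK; clear; lia.
Qed.

(** Compared with [deficit_D], this identifies [D_min n] as the index of the balanced double
    star. *)
Lemma D_min_half n : 4 <= n ->
  2 * D_min n + n = 4 * (n - 1) + n./2 ^ 2 + (n - n./2) ^ 2.
Proof.
move=> n4; have := odd_double_half n; rewrite /D_min -muln2.
have : 2 <= n./2 by lia.
by case: (odd n); move: n./2 => h h2 <- /=; nia.
Qed.

Lemma D_min_spec n a : 4 <= n -> a <= n ->
  2 * D_min n + n <= 4 * (n - 1) + a ^ 2 + (n - a) ^ 2 /\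
  (2 * D_min n + n = 4 * (n - 1) + a ^ 2 + (n - a) ^ 2 -> a <= n./2 -> a = n./2).
Proof.
move=> n4 an; rewrite D_min_half // -!addnA leq_add2l.
have : n./2 <= n - n./2 <= n./2 + 1 by lia.
have le_h : n./2 <= n by lia.
have [b En] : exists b, n = a + b by exists (n - a); lia.
have [k Ek] : exists k, n = n./2 + k by exists (n - n./2); lia.
have -> : n - n./2 = k by lia.
have -> : n - a = b by lia.
have : a + b = n./2 + k by rewrite -En -Ek.
move: n./2 => h E /andP [hk1 hk2]; split.
  have [le_a|lt_a] := leqP a h.
    have [e Ee] : exists e, h = a + e by exists (h - a); lia.
    have Eb : b = k + e by lia.
    by rewrite Ee Eb; nia.
  have [e Ee] : exists e, a = h + 1 + e by exists (a - h - 1); lia.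
  have Ek' : k = b + 1 + e by lia.
  by rewrite Ee Ek'; nia.
move=> /addnI E2 le_a.
have [e Ee] : exists e, h = a + e by exists (h - a); lia.
have Eb : b = k + e by lia.
case: e Ee Eb => [|e] Ee Eb; first by lia.
by move: E2; rewrite Ee Eb; nia.
Qed.

Lemma D_min_lt_T_min n q r : 4 <= n <= 56 -> 0 < q -> 1 <= r <= 2 * q + 1 ->
  n = q ^ 2 + r -> D_min n < T_min q r.
Proof.
move=> n56 q0 rq En; rewrite {n}En in n56 *.
(* As n is at most 56, q is at most 7 and r at most 15, which leaves a finite computation. *)
have q7 : q \in iota 1 7 by rewrite mem_iota; nia.
have r15 : r \in iota 1 15 by rewrite mem_iota; nia.
have : all (fun q => all (fun r => (4 <= q ^ 2 + r <= 56) && (r <= 2 * q + 1) ==>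
    (D_min (q ^ 2 + r) < T_min q r)) (iota 1 15)) (iota 1 7) by vm_compute.
move=> /allP /(_ _ q7) /allP /(_ _ r15) /implyP; apply.
by rewrite n56; case/andP: rq.
Qed.

Lemma T_min_lt_D_min n q r : 58 <= n -> 0 < q -> 1 <= r <= 2 * q + 1 ->
  n = q ^ 2 + r -> T_min q r < D_min n.
Proof.
move=> n58 q0 rq En; have q7 : 7 <= q by nia.
have [q8|q8] := leqP 8 q; last first.
  have Eq : q = 7 by lia.
  have r15 : r \in iota 9 7 by rewrite mem_iota; lia.
  rewrite En Eq.
  have : all (fun r => T_min 7 r < D_min (7 ^ 2 + r)) (iota 9 7) by vm_compute.
  by move=> /allP /(_ _ r15).
(* A bound free of parity: equality for even n, a loss of one for odd n. *)
have D4 : n ^ 2 + 6 * n <= 4 * D_min n + 8.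
  have := odd_double_half n; rewrite /D_min -muln2.
  have : 2 <= n./2 by lia.
  by case: (odd n); move: n./2 => h h2 <- /=; nia.
suff : 4 * T_min q r + 8 < n ^ 2 + 6 * n by lia.
have [e Eq] : exists e, q = 8 + e by exists (q - 8); lia.
case/andP: rq => r1 _.
have [s Er] : exists s, r = s.+1 by exists r.-1; lia.
(* Removes the truncated subtraction in [T_min]; the condition on [Z] covers the case where the
   difference is 0. *)
have sub X Y Z : 8 < Z -> 4 * X + 8 < Z + 4 * Y -> 4 * (X - Y) + 8 < Z by lia.
have n8 : 8 < n ^ 2 + 6 * n by lia.
rewrite /T_min; case: ifP => _; apply: sub => //; rewrite En Eq Er; clear; nia.
Qed.

Lemma square_decomposition_57 q r : 0 < q -> 1 <= r <= 2 * q + 1 -> 57 = q ^ 2 + r -> q = 7 /\ r = 8.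
Proof.
move=> q0 rq E; have E7 : q = 7 by nia.
by rewrite E7 in E *; split=> //; lia.
Qed.

Lemma sorted_two_values t s : sorted leq s -> all (fun a => (a == t) || (a == t.+1)) s ->
  s = nseq (count_mem t s) t ++ nseq (count_mem t.+1 s) t.+1.
Proof.
elim: s => //= a s IHs ss /andP [a_t s_t]; have {IHs} := IHs (path_sorted ss) s_t.
case/orP: a_t => /eqP Ea.
  by rewrite Ea eqxx (ltn_eqF (ltnSn t)) /= add0n => {1}->.
have c0 : count_mem t s = 0.
  apply/count_memPn/negP => ts.
  by have /allP /(_ t ts) := order_path_min leq_trans ss; rewrite Ea ltnn.
by rewrite Ea eqxx (gtn_eqF (ltnSn t)) c0 /= => {1}->.
Qed.

Lemma T_params_seq n k bs : T_params n k 0 bs ->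
  [/\ size (tally_seq bs) = k, (size (tally_seq bs) + sumn (tally_seq bs)).+1 = n
    & diameter (T_seq (tally_seq bs)) = 4].
Proof.
move=> [k2 _ bs_pos Ek En].
have sz : size (tally_seq bs) = k.
  by rewrite size_tally_seq sumnE big_map.
have su : sumn (tally_seq bs) = \sum_(p <- bs) p.2 * p.1.
  elim: (bs) => [|p bs' IH]; first by rewrite big_nil.
  by rewrite /tally_seq /= sumn_cat sumn_nseq IH big_cons mulnC.
split=> //; first by rewrite sz su -En; lia.
have pos i : i < k -> 0 < nth 0 (tally_seq bs) i.
  rewrite -sz => /(mem_nth 0) /flattenP [l /mapP [p pbs ->]].
  by move/nseqP => [-> _]; have /andP [] := allP bs_pos _ pbs.
have k0 : 0 < size (tally_seq bs) by lia.
have k1 : 1 < size (tally_seq bs) by lia.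
by apply: (@T_diameter4 _ _ (Ordinal k0) (Ordinal k1)); rewrite // pos //= -sz.
Qed.

Lemma is_T_seq n k bs G : T_params n k 0 bs ->
  is_T n k 0 bs G <-> isomorphic G (T_seq (tally_seq bs)).
Proof.
move=> Tp; have [sz _ _] := T_params_seq Tp; rewrite /is_T /T_seq.
(* The two graphs are indexed by ['I_k] and ['I_(size (tally_seq bs))]; eliminating the equation
   [sz] makes these types coincide. *)
by move: (Tp); case: _ / sz => Tp'; split=> [[]|].
Qed.

Lemma deficit_T_seq4 n s : (size s + sumn s).+1 = n -> diameter (T_seq s) = 4 ->
  deficit (T_seq s) = 2 * T_value [seq a.+1 | a <- s] /\ sumn [seq a.+1 | a <- s] + 1 = n.
Proof.
move=> En d4; have su : sumn [seq a.+1 | a <- s] = size s + sumn s.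
  by elim: (s) => //= a s' ->; lia.
split; last by rewrite su addn1.
have := deficit_T_seq s; rewrite d4 /T_value size_map big_map su.
by move: (deficit _) (\sum_(a <- s) _) (size s + sumn s) => F A N; lia.
Qed.

(* The last alternative collects the diameters at least five. *)
Lemma tree_deficit n (G : sgraph) : 4 <= n -> tree_on n G ->
  [\/ isomorphic G (star n),
      exists2 a, 2 <= a <= n./2 & isomorphic G (D_graph n a),
      exists s, [/\ sorted leq s, isomorphic G (T_seq s),
        sumn [seq a.+1 | a <- s] + 1 = n & deficit G = 2 * T_value [seq a.+1 | a <- s]]
    | 2 * D_min n < deficit G \/
      exists2 b, sumn b + 1 = n & 2 * T_value b < deficit G].
Proof.
move=> n4 tnG; have [iS|iD|[s [ss En iG d4]]|d5] := tree_cases (ltnW n4) tnG.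
- by constructor 1.
- by constructor 2.
- have [dE sE] := deficit_T_seq4 En d4.
  by constructor 3; exists s; rewrite (deficit_isomorphic iG).
have [cG tG] := tnG; constructor 4.
case: (boolP (odd (diameter G))) => od.
  have [a [b [ab lt_ab]]] := deficit_odd_diameter tG od d5; left.
  rewrite cG in ab lt_ab; have an : a <= n by lia.
  have [le_a _] := D_min_spec n4 an.
  have Eb : b = n - a by lia.
  by rewrite Eb in lt_ab; lia.
have [|s Es lt_s] := deficit_even_diameter tG od; first by lia.
right; exists s; first by rewrite Es cG; lia.
by rewrite /T_value Es.
Qed.

(** * Smallest and second smallest values *)

Lemma isomorphic_refl (G : sgraph) : isomorphic G G.
Proof. by exists id => //; exists id. Qed.

Lemma reverse_Wiener_eq n (G : sgraph) v : 0 < n -> tree_on n G ->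
  reverse_Wiener G = v%:R%R <-> deficit G = 2 * v.
Proof.
move=> n0 [cG [conG _]]; rewrite (reverse_Wiener_deficit conG) ?cG //.
split=> [E|->]; last by rewrite natrM; field.
by apply/eqP; rewrite -(eqr_nat rat) natrM -E; apply/eqP; field.
Qed.

Lemma D_min_gt n : 4 <= n -> n - 1 < D_min n.
Proof.
move=> n4; have := odd_double_half n; rewrite /D_min -muln2.
have : 2 <= n./2 by lia.
by case: (odd n); move: n./2 => h h2 <- /=; nia.
Qed.

Lemma T_value_gt b : 0 < sumn b -> sumn b < T_value b.
Proof. by case: b => //= a b; rewrite /T_value /=; nia. Qed.

Lemma deficit_D_spec n a (G : sgraph) : 4 <= n -> 2 <= a <= n./2 ->
  isomorphic G (D_graph n a) ->
  [/\ tree_on n G, 2 * D_min n <= deficit G & deficit G = 2 * D_min n <-> a = n./2].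
Proof.
move=> n4 /andP [a2 an] iG; have an' : a + 2 <= n by lia.
have a0n : 0 < a < n by lia.
have := deficit_D a2 an'; rewrite -(deficit_isomorphic iG) => dE.
have le_an : a <= n by lia.
have [le_d eq_d] := D_min_spec n4 le_an; split.
- apply: (isomorphic_T_seq_tree_on (isomorphic_trans iG (D_T_seq a0n))).
  by rewrite /= size_nseq sumn_nseq; lia.
- by move: dE le_d; lia.
- split=> [E|E]; first by apply: eq_d => //; rewrite -dE E.
  by apply: (@addIn n); rewrite dE D_min_half // E.
Qed.

Lemma nonstar_deficit n (G : sgraph) : 4 <= n -> tree_on n G ->
  isomorphic G (star n) \/ 2 * (n - 1) < deficit G.
Proof.
move=> n4 tG; have Dgt := D_min_gt n4.
case: (tree_deficit n4 tG) => [|[a a_n iG]|[s [_ _ sE dE]]|[lt_d|[b bE lt_d]]];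
  [by left| | | |]; right.
- by have [_ le_d _] := deficit_D_spec n4 a_n iG; lia.
- by have := @T_value_gt [seq a.+1 | a <- s]; lia.
- by lia.
- by have := @T_value_gt b; lia.
Qed.

Lemma star_tree_on n (G : sgraph) : 0 < n -> isomorphic G (star n) -> tree_on n G.
Proof.
move=> n0 iG; apply: (isomorphic_T_seq_tree_on (isomorphic_trans iG (star_T_seq n0))).
by rewrite size_nseq sumn_nseq mul0n addn0 prednK.
Qed.

Lemma star_smallest n : 4 <= n ->
  smallest (reverse_Wiener_values n) (n%:R - 1)%R /\
  attained_exactly_by n (n%:R - 1)%R (fun G => isomorphic G (star n)).
Proof.
move=> n4; have n0 : 0 < n by lia.
have -> : (n%:R - 1 = (n - 1)%:R :> rat)%R by rewrite natrB.
have starV G : isomorphic G (star n) -> deficit G = 2 * (n - 1).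
  by move=> /deficit_isomorphic ->; rewrite deficit_star //; lia.
split; first split.
- have tS := star_tree_on n0 (isomorphic_refl (star n)); exists (star n) => //.
  by apply/(reverse_Wiener_eq _ n0 tS)/starV/isomorphic_refl.
- move=> _ [G tG <-]; have [cG [conG _]] := tG.
  rewrite (reverse_Wiener_deficit conG) ?cG // ler_pdivlMr // -natrM ler_nat.
  by case: (nonstar_deficit n4 tG) => [/starV ->|]; lia.
move=> G; split=> [[tG /(reverse_Wiener_eq _ n0 tG) dG]|iG].
  by case: (nonstar_deficit n4 tG) => //; rewrite dG ltnn.
have tG := star_tree_on n0 iG; split=> //.
by apply/(reverse_Wiener_eq _ n0 tG)/starV.
Qed.

(** The common frame of all three ranges of [n]. The condition [n - 1 < v] separates [v] from the
    value of the star and so keeps the star out of the attaining graphs. *)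
Lemma second_smallest_attained n v (P : sgraph -> Prop) : 4 <= n -> n - 1 < v ->
  (forall G, tree_on n G -> isomorphic G (star n) \/
     2 * v <= deficit G /\ (deficit G = 2 * v -> P G)) ->
  (forall G, P G -> tree_on n G /\ deficit G = 2 * v) -> (exists G, P G) ->
  second_smallest (reverse_Wiener_values n) v%:R%R /\ attained_exactly_by n v%:R%R P.
Proof.
move=> n4 nv lb att [G0 PG0]; have n0 : 0 < n by lia.
have [smin sat] := star_smallest n4.
split; last first.
  move=> G; split=> [[tG /(reverse_Wiener_eq _ n0 tG) dG]|/att [tG dG]]; last first.
    by split=> //; apply/(reverse_Wiener_eq _ n0 tG).
  case: (lb G tG) => [iG|[_]]; last exact.
  have := deficit_isomorphic iG; rewrite dG deficit_star; lia.
exists (n%:R - 1)%R => //; split; first split.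
- have [tG dG] := att _ PG0; exists G0 => //; exact/(reverse_Wiener_eq _ n0 tG).
- have -> : (n%:R - 1 = (n - 1)%:R :> rat)%R by rewrite natrB.
  by move/eqP; rewrite eqr_nat; lia.
move=> w [[G tG Ew] nw]; have [cG [conG _]] := tG.
case: (lb G tG) => [iG|[le_d _]]; first by case: nw; rewrite -Ew; have [] := (sat G).2 iG.
by rewrite -Ew (reverse_Wiener_deficit conG) ?cG // ler_pdivlMr // -natrM ler_nat mulnC.
Qed.

Lemma is_T_deficit n k bs v (G : sgraph) : T_params n k 0 bs ->
  T_value [seq a.+1 | a <- tally_seq bs] = v -> is_T n k 0 bs G ->
  tree_on n G /\ deficit G = 2 * v.
Proof.
move=> Tp <- /(is_T_seq _ Tp) iG; have [_ En d4] := T_params_seq Tp.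
have [dE _] := deficit_T_seq4 En d4.
by split; [exact: isomorphic_T_seq_tree_on iG En | rewrite (deficit_isomorphic iG)].
Qed.

(** Equality in [T_min_spec] leaves i entries q - 1 and j entries q, with (i + j) q + j = n - 1. Off
    the tie i + j is known, hence so are i and j. At the tie, j = q (q + 1 - (i + j)): either j = 0
    and i = q + 1, or j >= q, which forces i = 0 and j = q. *)
Lemma T_min_seq q r s : 0 < q -> 1 <= r <= 2 * q + 1 -> sorted leq s ->
  sumn [seq a.+1 | a <- s] + 1 = q ^ 2 + r -> T_value [seq a.+1 | a <- s] = T_min q r ->
  [/\ r <= q -> s = nseq (q - r + 1) (q - 1) ++ nseq (r - 1) q,
      r = q + 1 -> s = nseq q q \/ s = nseq (q + 1) (q - 1)
    & q + 2 <= r -> s = nseq (2 * (q + 1) - r) (q - 1) ++ nseq (r - q - 1) q].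
Proof.
move=> q0 rq ss Es Ev; have [_ /(_ Ev)] := T_min_spec q0 rq Es.
rewrite all_map size_map => -[alls szq szq1].
case: q q0 rq Es alls szq szq1 {Ev} => // t _ rq Es alls szq szq1.
have := @sorted_two_values t s ss.
have -> : all (fun a => (a == t) || (a == t.+1)) s.
  by apply: sub_all alls => a /=; rewrite addn1 !eqSS.
move=> /(_ isT); move: (count_mem t s) (count_mem t.+1 s) => i j E.
move: Es szq szq1; rewrite {}E map_cat !map_nseq sumn_cat !sumn_nseq size_cat !size_nseq.
rewrite subn1 succnK => Es szq szq1; split.
- move=> rt; have Eij := szq rt; have Ej : j = r - 1 by nia.
  by rewrite Ej; congr (nseq _ _ ++ _); lia.
- move=> Er; have [Ej|Ej] := posnP j.
    by right; rewrite Ej cats0; congr nseq; nia.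
  have EK : t.+1 * (i + j) + j = t.+1 * t.+2 by move: Es; rewrite Er; clear; lia.
  have K1 : i + j < t.+2.
    rewrite -(ltn_pmul2l (ltn0Sn t)) -EK; clear -Ej; lia.
  (* The witness e is the defect q - (i + j); then j = q (1 + e) is at least q, so both i and e
     vanish. *)
  have [e Ee] : exists e, t.+1 = i + j + e by exists (t.+1 - (i + j)); lia.
  have jE : j = t.+1 * (1 + e).
    have E2 : t.+2 = i + j + (1 + e) by lia.
    by move/eqP: EK; rewrite E2 (mulnDr t.+1 (i + j)) eqn_add2l => /eqP.
  left; have Ei : i = 0 by move: jE Ee; clear; nia.
  by rewrite Ei; congr nseq; nia.
- move=> rt; have Eij := szq1 rt; have Ej : j = r - t.+1 - 1 by nia.
  by rewrite Ej; congr (nseq _ _ ++ _); lia.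
Qed.

Lemma T_value_two i j t : T_value [seq a.+1 | a <- nseq i t ++ nseq j t.+1] =
  (i + j + 1) * (i * t.+1 + j * t.+2) + i * t.+1 ^ 2 + j * t.+2 ^ 2.
Proof.
rewrite /T_value map_cat !map_nseq sumn_cat !sumn_nseq size_cat !size_nseq.
rewrite big_cat /= !big_nseq !iter_addn_0; lia.
Qed.

Lemma T_params1 n k t : 2 <= k -> 1 <= t -> k + 1 + k * t = n ->
  T_params n k 0 [:: (t, k)].
Proof. by move=> k2 t1 <-; split=> //=; rewrite ?big_seq1 ?t1 //=; lia. Qed.

Lemma T_params2 n k t i j : 2 <= k -> 1 <= t -> 1 <= i -> 1 <= j -> i + j = k ->
  k + 1 + (i * t + j * t.+1) = n -> T_params n k 0 [:: (t, i); (t.+1, j)].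
Proof.
by move=> k2 t1 i1 j1 Ek <-; split=> //=; rewrite ?big_cons ?big_nil ?t1 ?i1 ?ltnSn //=; lia.
Qed.

Lemma tally_seq1 (t i : nat) : tally_seq [:: (t, i)] = nseq i t.
Proof. by rewrite /tally_seq /= cats0. Qed.

Lemma tally_seq2 (t i u j : nat) : tally_seq [:: (t, i); (u, j)] = nseq i t ++ nseq j u.
Proof. by rewrite /tally_seq /= cats0. Qed.

Lemma T_value_nseq i t : T_value [seq a.+1 | a <- nseq i t] =
  (i + 1) * (i * t.+1) + i * t.+1 ^ 2.
Proof. by have := T_value_two i 0 t; rewrite cats0 => ->; lia. Qed.

Lemma is_D_deficit n (G : sgraph) : 4 <= n -> is_D n n./2 G ->
  tree_on n G /\ deficit G = 2 * D_min n.
Proof.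
by move=> n4 [h iG]; have [tG _ dG] := deficit_D_spec n4 h iG; split=> //; apply/dG.
Qed.

(** * The ranges of n *)

Lemma second_smallest_D n q r : 4 <= n <= 56 -> 0 < q -> 1 <= r <= 2 * q + 1 ->
  n = q ^ 2 + r ->
  second_smallest (reverse_Wiener_values n) (D_min n)%:R%R /\
  attained_exactly_by n (D_min n)%:R%R (is_D n n./2).
Proof.
move=> n56 q0 rq En; have n4 : 4 <= n by lia.
have lt_DT := D_min_lt_T_min n56 q0 rq En.
apply: second_smallest_attained => //; first exact: D_min_gt.
- move=> G tG; case: (tree_deficit n4 tG) => [|[a a_n iG]|[s [_ _ sE ->]]|H]; [by left| | |];
    right.
  + have [_ le_d [eq_d _]] := deficit_D_spec n4 a_n iG; split=> // /eq_d Ea.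
    by rewrite -Ea; split=> //; lia.
  + rewrite En in sE; have [le_T _] := T_min_spec q0 rq sE.
    by split=> [|E]; [|exfalso]; lia.
  + case: H => [lt_d|[b bE lt_d]]; first by split=> [|E]; [|exfalso]; lia.
    rewrite En in bE; have [le_T _] := T_min_spec q0 rq bE.
    by split=> [|E]; [|exfalso]; lia.
- by move=> G; exact: is_D_deficit.
- by exists (D_graph n n./2); split; [lia | exact: isomorphic_refl].
Qed.

Lemma T_min_gt q r : 0 < q -> 1 <= r -> q ^ 2 + r - 1 < T_min q r.
Proof.
case: q r => [|q] [|r] // _ _; rewrite addnS subn1 succnK /T_min.
case: ifPn => rq; rewrite ltn_subRL; first by clear; nia.
have [e Er] : exists e, r = q.+1 + e by exists (r - q.+1); lia.
by rewrite Er; clear; nia.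
Qed.

(** Allowing equality with [D_min n], at the price that [P] then contains the balanced double star,
    lets n = 57 share the argument with n >= 58. *)
Lemma second_smallest_T n q r (P : sgraph -> Prop) : 57 <= n -> 0 < q ->
  1 <= r <= 2 * q + 1 -> n = q ^ 2 + r -> T_min q r <= D_min n ->
  (T_min q r = D_min n -> forall G, is_D n n./2 G -> P G) ->
  (forall G s, sorted leq s -> sumn [seq a.+1 | a <- s] + 1 = n -> isomorphic G (T_seq s) ->
     T_value [seq a.+1 | a <- s] = T_min q r -> P G) ->
  (forall G, P G -> tree_on n G /\ deficit G = 2 * T_min q r) -> (exists G, P G) ->
  second_smallest (reverse_Wiener_values n) (T_min q r)%:R%R /\
  attained_exactly_by n (T_min q r)%:R%R P.
Proof.
move=> n57 q0 rq En le_TD PD PT att exP; have n4 : 4 <= n by lia.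
apply: second_smallest_attained => //.
- by case/andP: rq => r1 _; rewrite En; apply: T_min_gt.
- move=> G tG; case: (tree_deficit n4 tG) => [|[a a_n iG]|[s [ss iG sE dE]]|H]; [by left| | |];
    right.
  + have [_ le_d [eq_d _]] := deficit_D_spec n4 a_n iG; split; first by lia.
    move=> dG; have ETD : T_min q r = D_min n by lia.
    have Ea : a = n./2 by apply: eq_d; lia.
    by apply: PD => //; rewrite -Ea; split=> //; lia.
  + have sE' := sE; rewrite En in sE'; have [le_T _] := T_min_spec q0 rq sE'.
    split; first by lia.
    by move=> dG; apply: (PT G s) => //; lia.
  + case: H => [lt_d|[b bE lt_d]]; first by split=> [|E]; [|exfalso]; lia.
    rewrite En in bE; have [le_T _] := T_min_spec q0 rq bE.
    by split=> [|E]; [|exfalso]; lia.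
Qed.

(** The two halves h and u of n satisfy h^2 + u^2 = n^2 - 2 h u, which turns [D_min_half] into the
    closed form. *)
Lemma D_min_rat n : 4 <= n ->
  ((D_min n)%:R = n%:R ^+ 2 / 2 + 3 * n%:R / 2 - 2 - n./2%:R * (uphalf n)%:R :> rat)%R.
Proof.
move=> n4; have := D_min_half n4; have -> : n - n./2 = uphalf n by lia.
move/(congr1 (fun k => k%:R : rat)); rewrite !natrD !natrM natrB ?natrX; last by lia.
have : (n%:R = n./2%:R + (uphalf n)%:R :> rat)%R by rewrite -natrD; congr (_%:R)%R; lia.
move: (n./2%:R : rat)%R ((uphalf n)%:R : rat)%R ((D_min n)%:R : rat)%R (n%:R : rat)%R.
by move=> h u D N -> E; lra.
Qed.

Lemma T_min_rat q r : 0 < q -> 1 <= r ->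
  ((T_min q r)%:R = (if (r <= q)%N
                  then 2 * q%:R ^+ 3 + q%:R ^+ 2 + 3 * r%:R * q%:R
                         - 3 * q%:R + 2 * r%:R - 2
                  else 2 * q%:R ^+ 3 + q%:R ^+ 2 + 3 * r%:R * q%:R
                         - 4 * q%:R + 3 * r%:R - 3) :> rat)%R.
Proof.
move=> q0 r1; rewrite /T_min; case: ifPn => rq; (rewrite natrB; last by nia);
  by rewrite !(natrD, natrX, natrM); ring.
Qed.

(** The parameter list stays arbitrary because [T_params] forbids multiplicity 0: r = 1 needs a
    single pair, larger r two, while the underlying sequence has one common form. *)
Lemma second_smallest_T_low n q r : 57 <= n -> 1 <= r <= q -> n = q ^ 2 + r -> T_min q r <= D_min n ->
  T_min q r <> D_min n -> forall bs, T_params n q 0 bs ->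
  tally_seq bs = nseq (q - r + 1) (q - 1) ++ nseq (r - 1) q ->
  second_smallest (reverse_Wiener_values n) (T_min q r)%:R%R /\
  attained_exactly_by n (T_min q r)%:R%R (is_T n q 0 bs).
Proof.
move=> n57 rq En le_TD ne_TD bs Tp Ebs; have q0 : 0 < q by lia.
have rq' : 1 <= r <= 2 * q + 1 by lia.
apply: (second_smallest_T n57 q0 rq' En le_TD) => //.
- move=> G s ss sE iG Ev; rewrite En in sE.
  have [H _ _] := T_min_seq q0 rq' ss sE Ev.
  by apply/(is_T_seq _ Tp); rewrite Ebs -H //; case/andP: rq.
- move=> G; apply: is_T_deficit => //; rewrite Ebs.
  have [t Et] : exists t, q = t.+1 by exists q.-1; lia.
  case/andP: rq => r1 rq; rewrite Et subn1 succnK T_value_two /T_min -Et rq.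
  have [e Ee] : exists e, q = r + e by exists (q - r); lia.
  have [r' Er] : exists r', r = r'.+1 by exists r.-1; lia.
  have -> : q - r + 1 = e + 1 by lia.
  rewrite Ee Er subn1 succnK; clear; lia.
- by exists (T_seq (tally_seq bs)); apply/(is_T_seq _ Tp)/isomorphic_refl.
Qed.

Lemma second_smallest_T_high n q r : 57 <= n -> q + 2 <= r <= 2 * q + 1 -> n = q ^ 2 + r ->
  T_min q r <= D_min n -> T_min q r <> D_min n -> forall bs, T_params n (q + 1) 0 bs ->
  tally_seq bs = nseq (2 * (q + 1) - r) (q - 1) ++ nseq (r - q - 1) q ->
  second_smallest (reverse_Wiener_values n) (T_min q r)%:R%R /\
  attained_exactly_by n (T_min q r)%:R%R (is_T n (q + 1) 0 bs).
Proof.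
move=> n57 rq En le_TD ne_TD bs Tp Ebs; have q0 : 0 < q by lia.
have rq' : 1 <= r <= 2 * q + 1 by lia.
apply: (second_smallest_T n57 q0 rq' En le_TD) => //.
- move=> G s ss sE iG Ev; rewrite En in sE.
  have [_ _ H] := T_min_seq q0 rq' ss sE Ev.
  by apply/(is_T_seq _ Tp); rewrite Ebs -H //; case/andP: rq.
- move=> G; apply: is_T_deficit => //; rewrite Ebs.
  have [t Et] : exists t, q = t.+1 by exists q.-1; lia.
  rewrite Et subn1 succnK T_value_two /T_min -Et.
  have -> : (r <= q) = false by lia.
  have [j Ej] : exists j, r = q + 1 + j by exists (r - q - 1); lia.
  have [e Ee] : exists e, q + 1 = j + e by exists (q + 1 - j); lia.
  have -> : 2 * (q + 1) - r = e by lia.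
  have -> : r - q - 1 = j by lia.
  have Eq : e + j = q + 1 by lia.
  rewrite Eq Ej; have -> : e = q + 1 - j by lia.
  have jq : j <= q + 1 by lia.
  have [e' Ee'] : exists e', q + 1 = j + e' by exists (q + 1 - j); lia.
  have -> : q + 1 - j = e' by lia.
  have Et2 : t.+2 = j + e' by lia.
  nia.
- by exists (T_seq (tally_seq bs)); apply/(is_T_seq _ Tp)/isomorphic_refl.
Qed.

(** The first alternative holds for n = 57 and is void from 58 on, so [P] has three families there
    and two afterwards. *)
Lemma second_smallest_T_tie n q (r := q + 1) (P : sgraph -> Prop) : 57 <= n -> n = q ^ 2 + r ->
  T_min q r <= D_min n ->
  (forall G, P G <-> [\/ T_min q r = D_min n /\ is_D n n./2 G,
                       is_T n q 0 [:: (q, q)] G | is_T n (q + 1) 0 [:: (q - 1, q + 1)] G]) ->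
  second_smallest (reverse_Wiener_values n) (T_min q r)%:R%R /\
  attained_exactly_by n (T_min q r)%:R%R P.
Proof.
move=> n57 En le_TD EP; have q7 : 7 <= q by nia.
have q0 : 0 < q by lia.
have rq : 1 <= r <= 2 * q + 1 by lia.
have Tp1 : T_params n q 0 [:: (q, q)] by apply: T_params1; rewrite ?En /r; lia.
have Tp2 : T_params n (q + 1) 0 [:: (q - 1, q + 1)].
  by apply: T_params1; rewrite ?En /r; nia.
apply: (second_smallest_T n57 q0 rq En le_TD).
- by move=> ETD G DG; apply/EP; constructor 1.
- move=> G s ss sE iG Ev; rewrite En in sE.
  have [_ H _] := T_min_seq q0 rq ss sE Ev; apply/EP.
  case: (H erefl) => Es; [constructor 2; apply/(is_T_seq _ Tp1) | constructor 3; apply/(is_T_seq _ Tp2)];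
    by rewrite tally_seq1 -Es.
- have ET : T_min q r = 2 * (q + 1) * (q * (q + 1)).
    by rewrite /T_min /r addn1 ltnn; clear; nia.
  move=> G /EP [[-> DG]|TG|TG]; first by apply: is_D_deficit => //; lia.
    apply: (is_T_deficit Tp1) TG; rewrite tally_seq1 T_value_nseq ET; clear; lia.
  apply: (is_T_deficit Tp2) TG; rewrite tally_seq1 T_value_nseq ET.
  by rewrite subn1 prednK //; clear; lia.
- by exists (T_seq (tally_seq [:: (q, q)])); apply/EP; constructor 2;
    apply/(is_T_seq _ Tp1)/isomorphic_refl.
Qed.

Lemma second_smallest_large n q r : 58 <= n -> 0 < q -> 1 <= r <= 2 * q + 1 ->
  n = q ^ 2 + r ->
  [/\ second_smallest (reverse_Wiener_values n) (T_min q r)%:R%R,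
      r = 1 -> attained_exactly_by n (T_min q r)%:R%R (is_T n q 0 [:: (q - 1, q)]),
      2 <= r <= q -> attained_exactly_by n (T_min q r)%:R%R
        (is_T n q 0 [:: (q - 1, q - r + 1); (q, r - 1)]),
      r = q + 1 -> attained_exactly_by n (T_min q r)%:R%R (fun G =>
        is_T n q 0 [:: (q, q)] G \/ is_T n (q + 1) 0 [:: (q - 1, q + 1)] G)
    & q + 2 <= r <= 2 * q + 1 -> attained_exactly_by n (T_min q r)%:R%R
        (is_T n (q + 1) 0 [:: (q - 1, 2 * (q + 1) - r); (q, r - q - 1)])].
Proof.
move=> n58 q0 rq En; have lt_TD := T_min_lt_D_min n58 q0 rq En.
have le_TD := ltnW lt_TD; have n57 : 57 <= n by lia.
have ne_TD : T_min q r <> D_min n by lia.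
have q7 : 7 <= q by nia.
have [t Et] : exists t, q = t.+1 by exists q.-1; lia.
have c1 : r = 1 -> second_smallest (reverse_Wiener_values n) (T_min q r)%:R%R /\
    attained_exactly_by n (T_min q r)%:R%R (is_T n q 0 [:: (q - 1, q)]).
  move=> r1; apply: second_smallest_T_low => //; first by lia.
    by apply: T_params1; rewrite ?En ?r1; nia.
  by rewrite tally_seq1 r1 cats0; congr nseq; lia.
have c2 : 2 <= r <= q -> second_smallest (reverse_Wiener_values n) (T_min q r)%:R%R /\
    attained_exactly_by n (T_min q r)%:R%R (is_T n q 0 [:: (q - 1, q - r + 1); (q, r - 1)]).
  move=> r2; apply: second_smallest_T_low => //; [by lia | | by rewrite tally_seq2].
  have -> : q - 1 = t by lia.
  have [e Ee] : exists e, q = r + e by exists (q - r); lia.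
  have [u Eu] : exists u, r = u.+1 by exists r.-1; lia.
  by rewrite [X in (X, r - 1)]Et; apply: T_params2; lia.
have c3 : r = q + 1 -> second_smallest (reverse_Wiener_values n) (T_min q r)%:R%R /\
    attained_exactly_by n (T_min q r)%:R%R (fun G =>
        is_T n q 0 [:: (q, q)] G \/ is_T n (q + 1) 0 [:: (q - 1, q + 1)] G).
  move=> Er; subst r; apply: second_smallest_T_tie => // G; split.
    by case; [constructor 2 | constructor 3].
  by case=> [[]|TG|TG] //; [left | right].
have c4 : q + 2 <= r <= 2 * q + 1 ->
    second_smallest (reverse_Wiener_values n) (T_min q r)%:R%R /\
    attained_exactly_by n (T_min q r)%:R%R
        (is_T n (q + 1) 0 [:: (q - 1, 2 * (q + 1) - r); (q, r - q - 1)]).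
  move=> r2; apply: second_smallest_T_high => //; last by rewrite tally_seq2.
  have [j Ej] : exists j, r = q + 1 + j by exists (r - q - 1); lia.
  have [e Ee] : exists e, q + 1 = j + e by exists (q + 1 - j); lia.
  have -> : 2 * (q + 1) - r = e by lia.
  have -> : r - q - 1 = j by lia.
  have -> : q - 1 = t by lia.
  by rewrite [X in (X, j)]Et; apply: T_params2; lia.
split; [|by case/c1|by case/c2|by case/c3|by case/c4].
have [rq1|rq1] := leqP r q; last first.
  have [|ne] := eqVneq r (q + 1); first by case/c3.
  by have [|] := c4; first by lia.
have [|ne] := eqVneq r 1; first by case/c1.
by have [|] := c2; first by lia.
Qed.

Theorem theorem1 (n q r : nat) (hn : 4 <= n) (hq : 0 < q)
    (hr : 1 <= r <= 2 * q + 1) (hnqr : n = q ^ 2 + r) :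
  [/\ smallest (reverse_Wiener_values n) (n%:R - 1)%R /\
      attained_exactly_by n (n%:R - 1)%R (fun G => isomorphic G (star n)),
      n <= 56 ->
        let v : rat := (n%:R ^+ 2 / 2 + 3 * n%:R / 2 - 2
                   - (n./2)%:R * (uphalf n)%:R)%R in
        second_smallest (reverse_Wiener_values n) v /\
        attained_exactly_by n v (is_D n n./2),
      n = 57 ->
        second_smallest (reverse_Wiener_values n) 896%R /\
        attained_exactly_by n 896%R (fun G =>
          [\/ is_D 57 28 G,
              is_T 57 7 0 [:: (7, 7)] G
            | is_T 57 8 0 [:: (6, 8)] G])
    & 58 <= n ->
        let v : rat := (if (r <= q)%N
                  then 2 * q%:R ^+ 3 + q%:R ^+ 2 + 3 * r%:R * q%:R
                         - 3 * q%:R + 2 * r%:R - 2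
                  else 2 * q%:R ^+ 3 + q%:R ^+ 2 + 3 * r%:R * q%:R
                         - 4 * q%:R + 3 * r%:R - 3)%R in
        [/\ second_smallest (reverse_Wiener_values n) v,
            r = 1 ->
              attained_exactly_by n v (is_T n q 0 [:: (q - 1, q)]),
            2 <= r <= q ->
              attained_exactly_by n v
                (is_T n q 0 [:: (q - 1, q - r + 1); (q, r - 1)]),
            r = q + 1 ->
              attained_exactly_by n v (fun G =>
                is_T n q 0 [:: (q, q)] G \/
                is_T n (q + 1) 0 [:: (q - 1, q + 1)] G)
          & q + 2 <= r <= 2 * q + 1 ->
              attained_exactly_by n v
                (is_T n (q + 1) 0
                   [:: (q - 1, 2 * (q + 1) - r); (q, r - q - 1)])]].
Proof.
split.
- exact: star_smallest.
- move=> n56 v; have n456 : 4 <= n <= 56 by rewrite hn.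
  by rewrite /v -D_min_rat //; exact: second_smallest_D n456 hq hr hnqr.
- move=> n57; rewrite n57 in hnqr *.
  (* Since 57 = 7^2 + 8, this is the tie r = q + 1, in which the double star takes part as well. *)
  have [q7 r8] := square_decomposition_57 hq hr hnqr; rewrite {}q7 {}r8 in hnqr.
  have ET : T_min 7 (7 + 1) = 896 by vm_compute.
  have ED : D_min 57 = 896 by vm_compute.
  rewrite -[X in second_smallest _ X]/(896%:R)%R -[X in attained_exactly_by _ X]/(896%:R)%R.
  rewrite -ET; apply: second_smallest_T_tie => // G.
  rewrite ET ED; split=> [[]|[[_]||]]; by [constructor 1 | constructor 2 | constructor 3].
- move=> n58 v; have -> : v = (T_min q r)%:R%R.
    by rewrite T_min_rat //; case/andP: hr.
  exact: second_smallest_large.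
Qed.
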